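(* Assume $F(b^*_{v,F})>0$ and $F$ is unknown to the bidder. For any $\gamma>1$, the regret of O-UCBid1 satisfies $$R_T^{v,F}\ \le\ \frac{4\sqrt2}{F(b^*_{v,F})}\sqrt{\gamma\log T}\,(\sqrt T+1)+O(1).$$
   Context: Model: at rounds $t=1,\dots,T$ a bidder submits $B_t\in[0,1]$. $(V_t)$ i.i.d. in $[0,1]$ with mean $v$; $(M_t)$ i.i.d. in $[0,1]$ with CDF $F$, independent of $(V_t)$. If $M_t\le B_t$ the bidder wins, pays $B_t$, receives and observes $V_t$; otherwise she does not observe $V_t$. $M_t$ is observed at the end of every round. $U_{v,F}(b)=(v-b)F(b)$, $b^*_{v,F}=\max\{\operatorname{argmax}_{b\in[0,1]}U_{v,F}(b)\}$, $R_T^{v,F}=T\max_bU_{v,F}(b)-\sum_{t=1}^T\mathbb E[U_{v,F}(B_t)]$. Notation: $N_t=\sum_{s=1}^{t-1}\mathbf 1\{M_s\le B_s\}$, $\hat V_t=\frac1{N_t}\sum_{s=1}^{t-1}V_s\mathbf 1\{M_s\le B_s\}$, $\epsilon_t=\sqrt{\gamma\log(t-1)/(2N_t)}$, $\hat F_t(b)=\frac1{t-1}\sum_{s=1}^{t-1}\mathbf 1\{M_s<b\}$, $\hat U_t(b)=(\hat V_t-b)\hat F_t(b)$. Algorithm O-UCBid1: $B_1=1$ and for $t\ge2$, $B_t=\max\{b\in[0,\hat V_t+\epsilon_t]:\ \hat U_t(b)\ge\max_{b'\in[0,1]}\hat U_t(b')-2\epsilon_t\}$. *)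

(* Defs.v *)
From HB Require Import structures.
From mathcomp Require Import all_boot all_order all_algebra.
From mathcomp Require Import all_classical all_reals all_analysis.
Set Implicit Arguments. Unset Strict Implicit. Unset Printing Implicit Defensive.
Import Order.TTheory GRing.Theory Num.Theory.
Local Open Scope classical_set_scope.
Local Open Scope ring_scope.

Section O_UCBid1.
Context {R : realType}.

Definition util (v : R) (F : R -> R) (b : R) : R := (v - b) * F b.

(** max_{b in [0,1]} U_{v,F}(b)  (the maximum is attained; written as a sup). *)
Definition util_max (v : R) (F : R -> R) : R :=
  sup [set util v F b | b in [set b : R | 0 <= b <= 1]].

(** b*_{v,F} = max (argmax_{b in [0,1]} U_{v,F}(b))  (written as a sup). *)
Definition bstar (v : R) (F : R -> R) : R :=
  sup [set b : R | 0 <= b <= 1 /\ util v F b = util_max v F].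

(** One step of O-UCBid1.  [vs s], [ms s] are the realized V_s, M_s
    (rounds are numbered from 1), [bs] is the list [B_1; ...; B_(t-1)] of
    past bids, so the current round is t = size bs + 1. *)
Definition next_bid (gamma : R) (vs ms : nat -> R) (bs : seq R) : R :=
  let n := size bs in
  if n == 0%N then 1 else
  let win s := (ms s <= nth 0 bs s.-1)%R in
  let N : R := \sum_(1 <= s < n.+1) (win s)%:R in
  let Vhat : R := (\sum_(1 <= s < n.+1) vs s * (win s)%:R) / N in
  let eps : R := Num.sqrt (gamma * ln (n%:R : R) / (2 * N)) in
  let Fhat (b : R) : R := (\sum_(1 <= s < n.+1) ((ms s < b)%R)%:R) / n%:R in
  let Uhat (b : R) : R := (Vhat - b) * Fhat b in
  let Uhat_max := sup [set Uhat b | b in [set b : R | 0 <= b <= 1]] in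
  sup [set b : R | 0 <= b <= 1 /\ b <= Vhat + eps /\ Uhat_max - 2 * eps <= Uhat b].

Fixpoint bids (gamma : R) (vs ms : nat -> R) (n : nat) : seq R :=
  if n is n'.+1 then
    let bs := bids gamma vs ms n' in rcons bs (next_bid gamma vs ms bs)
  else [::].

Definition bid (gamma : R) (vs ms : nat -> R) (t : nat) : R :=
  nth 0 (bids gamma vs ms t) t.-1.

Definition bidRV {T : Type} (gamma : R) (V M : nat -> T -> R) (t : nat) (w : T) : R :=
  bid gamma (fun s => V s w) (fun s => M s w) t.

Definition regret {d} {T : measurableType d} (P : probability T R)
  (v : R) (F : R -> R) (gamma : R) (V M : nat -> T -> R) (n : nat) : \bar R :=
  ((n%:R * util_max v F)%:E
    - \sum_(1 <= t < n.+1) 'E_P[fun w => util v F (bidRV gamma V M t w)])%E.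

Definition mutually_independent {d} {T : measurableType d} (P : probability T R)
  {I : eqType} (D : set I) (X : I -> T -> R) : Prop :=
  forall (J : seq I) (A : I -> set R),
    uniq J -> (forall i, i \in J -> D i) -> (forall i, measurable (A i)) ->
    P (\bigcap_(i in [set` J]) (X i @^-1` A i)) = (\prod_(i <- J) P (X i @^-1` A i))%E.

End O_UCBid1.

Definition VM {T R : Type} (V M : nat -> T -> R) (i : nat + nat) : T -> R :=
  match i with inl t => V t | inr t => M t end.

Definition round_index (i : nat + nat) : nat :=
  match i with inl t => t | inr t => t end.

(* Main.v *)
Require Import Defs.
From HB Require Import structures.
From mathcomp Require Import all_boot all_order all_algebra.
From mathcomp Require Import all_classical all_reals all_analysis.
From mathcomp Require Import measurable_realfun ring lra.
Import Order.TTheory GRing.Theory Num.Theory.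
Import numFieldNormedType.Exports.
Set Implicit Arguments. Unset Strict Implicit. Unset Printing Implicit Defensive.
Local Open Scope classical_set_scope.
Local Open Scope ring_scope.

(** Write [n = t - 1], [e = sqrt (gamma ln n / (2 n))], [b = bstar v F], and
    [win_t] for the indicator of [M_t <= B_t].  Outside bad events of summable
    probability, the regret of round [t] is at most
    [4 eps_t F(B_t) / F(b)].  Since [B_t] is a function of the past and [M_t] is
    independent of it, [E (eps_t F(B_t)) = E (eps_t win_t)], and
    [sum_t win_t / sqrt N_t <= 2 sqrt T] because [N] increases exactly at the wins.

    Three estimates control the bad events.
    - [|Vhat - v| < eps]: the process [exp (x S - x^2 N / 8)], where [S] sums the
      deviations [V_s - v] over the won rounds, is a supermartingale by Hoeffding's
      lemma; as [N] is random one peels over [N] in [[a^(2j), a^(2j+2))] with [a]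
      close to 1, which costs only a factor [ln n].
    - [b <= B_t]: for [g < b], the variables
      [(v-g) 1(M < g) - (v-b) 1(M <= b) + e 1(g <= M <= b)] have mean at most
      of order [e] and small variance, so that their average exceeds [2 e] with
      probability of order [n^(-2 gamma)]; this survives a union bound over a grid
      of [n] points, and no sharp DKW inequality is needed.
    - the regret bound for [B_t >= b] has slack, so there a union bound over the
      [n]-quantiles of [F] with plain Hoeffding estimates suffices.

    When the maximal utility is [0], the bound [B_t <= Vhat + eps] is enough; this
    case also covers the degenerate situation where the supremum defining [b] is
    not attained. *)

(** * Exponential inequalities and logarithms *)

Section real_inequalities.
Context {R : realType}.
Implicit Types x y p s t : R.

(** What shapes the estimates is that [gamma] is only assumed larger than 1. With
    [e^2 = gamma ln n / (2 n)], a Hoeffding bound at deviation e gives n^(-gamma): summable, but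
    with nothing left for a union over n points, be they the possible values of N or the bids of a
    grid. Each bad event finds its room elsewhere. For [Vhat], geometric peeling replaces the factor
    n by ln n. For [b <= B_t], the algorithm's slack 2 e and a variance bound double the exponent,
    and n times n^(-2 gamma) is summable. For the regret at [B_t >= b], the target constant 4 leaves
    room for deviations of 3/2 e, with exponent 9/4 gamma > 2. The cdf F may have atoms. Ties win,
    whereas [fhat] counts strict inequalities, so at b the empirical utility has to be read as a
    right limit, and the maximum of the true utility must be shown to be attained without continuity
    of F. The constant 4 sqrt 2 is 4 times sqrt (1/2), from the radius, times 2, from the sum of 1 /
    sqrt N over the wins. *)

Lemma derive_ge0_le (f df : R -> R) (a b : R) : a <= b ->
  (forall x, is_derive x 1 f (df x)) ->
  (forall x, a <= x <= b -> 0 <= df x) -> f a <= f b.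
Proof.
move=> ab Df df0; have cf : {within `[a, b], continuous f}.
  apply: continuous_subspaceT => x.
  by have [dfx _] := Df x; exact/differentiable_continuous/derivable1_diffP.
have [c cab fab] := MVT_segment ab (fun x _ => Df x) cf.
rewrite -subr_ge0 fab mulr_ge0 ?subr_ge0// df0//.
Qed.

(** Multiplied by [expR (- x)], the claim compares a function with its value 1 at 0, and a
    derivative of constant sign decides. For negative x the quadratic Taylor polynomial already
    dominates, and the cubic term is merely added. *)
Lemma expR_le_cubic x : `|x| <= 1 -> expR x <= 1 + x + x ^+ 2 / 2 + `|x| ^+ 3.
Proof.
move=> x1; rewrite -(ler_pM2r (expR_gt0 (- x))) -expRD subrr expR0.
have [x0|x0] := leP 0 x.
  rewrite (ger0_norm x0) in x1 *.
  pose f (y : R) : R := (1 + y + y ^+ 2 / 2 + y ^+ 3) * expR (- y).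
  pose df (y : R) : R := (5/2 * y ^+ 2 - y ^+ 3) * expR (- y).
  have f0 : f 0 = 1 by rewrite /f oppr0 expR0 !expr0n /= mul0r !addr0 mulr1.
  suff : f 0 <= f x by rewrite f0.
  apply: (derive_ge0_le (df := df)) => //.
    move=> y; rewrite /f /df; apply: is_derive_eq.
    by rewrite /GRing.scale/= ; field.
  move=> y /andP[y0 yx]; rewrite /df mulr_ge0 ?expR_ge0//.
  have -> : 5/2 * y ^+ 2 - y ^+ 3 = y ^+ 2 * (5/2 - y) by ring.
  by rewrite mulr_ge0 ?sqr_ge0//; lra.
pose f (y : R) : R := (1 - y + y ^+ 2 / 2) * expR y.
pose df (y : R) : R := (y ^+ 2 / 2) * expR y.
have x0' : 0 <= - x by lra.
have f0 : f 0 = 1 by rewrite /f expR0 !expr0n /= mul0r subr0 addr0 mulr1.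
have : f 0 <= f (- x); last first.
  rewrite f0 => /le_trans; apply.
  by rewrite /f ler_wpM2r ?expR_ge0// opprK sqrrN lerDl exprn_ge0.
apply: (derive_ge0_le (df := df)) => //.
  move=> y; rewrite /f /df; apply: is_derive_eq.
  by rewrite /GRing.scale/= ; field.
by move=> y _; rewrite /df mulr_ge0 ?expR_ge0// divr_ge0 ?sqr_ge0.
Qed.

(** Hoeffding's lemma for a Bernoulli variable. With s the success probability of the law tilted by
    y, the log moment generating function has second derivative s (1 - s), at most 1/4; two
    integrations from 0 give the quadratic exponent. *)
Lemma bernoulli_mgf_le p t : 0 <= p <= 1 ->
  1 - p + p * expR t <= expR (t * p + t ^+ 2 / 8).
Proof.
move=> /andP[p0 p1].
pose D (y : R) : R := 1 - p + p * expR y.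
have Dgt0 y : 0 < D y.
  rewrite /D; move: p0; rewrite le_eqVlt => /predU1P[<-|p0].
    by rewrite mul0r; lra.
  by rewrite ltr_wpDl ?mulr_gt0 ?expR_gt0//; lra.
have DneN y : D y != 0 by rewrite gt_eqF.
have DD (y : R) : is_derive y 1 D (p * expR y).
  by rewrite /D; apply: is_derive_eq; rewrite /GRing.scale/=; ring.
pose h (y : R) : R := y / 4 + p - p * expR y * (D y)^-1.
pose dh (y : R) : R := 4^-1 - (p * expR y) * (1 - p) * (D y) ^- 2.
have Dh (y : R) : is_derive y 1 h (dh y).
  rewrite /h; apply: is_derive_eq.
  rewrite /GRing.scale/= /dh.
  have pe : p * expR y = D y - (1 - p) by rewrite /D; ring.
  by rewrite pe; field; exact: DneN.
have dh0 y : 0 <= dh y.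
  rewrite /dh subr_ge0 ler_pdivrMr ?exprn_gt0//.
  have := sqr_ge0 ((1 - p) - p * expR y); rewrite /D; nra.
have h0 : h 0 = 0.
  by rewrite /h /D expR0 mulr1 subrK invr1 mulr1 mul0r add0r subrr.
pose g (y : R) : R := y * p + y ^+ 2 / 8 - ln (D y).
have Dg (y : R) : is_derive y 1 g (h y).
  have Dl : is_derive (D y) 1 (@ln R) (D y)^-1 by exact: is_derive1_ln.
  have Dc : is_derive y 1 (@ln R \o D) ((D y)^-1 * (p * expR y)).
    have := is_derive1_comp Dl (DD y); exact.
  rewrite /g; apply: is_derive_eq.
  by rewrite /GRing.scale/= /h; field.
have g0 : g 0 = 0.
  by rewrite /g /D expR0 mulr1 subrK ln1 expr0n/= !mul0r addr0 subrr.
suff : 0 <= g t.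
  rewrite /g subr_ge0 => lnD; rewrite -/(D t) -[D t]lnK ?posrE//.
  by rewrite ler_expR.
have [t0|t0] := leP 0 t.
  rewrite -g0; apply: (derive_ge0_le (df := h)) => // y /andP[y0 _].
  by rewrite -h0; apply: (derive_ge0_le (df := dh)).
(* For negative t the argument runs on the reflection [k y = g (- y)]: h is nondecreasing and
   vanishes at 0, so it is nonpositive on the left. *)
rewrite -g0 -(opprK t).
pose k (y : R) : R := g (- y).
have -> : g 0 = k 0 by rewrite /k oppr0.
rewrite -/(k (- t)); apply: (derive_ge0_le (df := fun y => - h (- y))).
- lra.
- move=> y; have Dn : is_derive y 1 (-%R : R -> R) (-1).
    by apply: is_derive_eq.
  have := is_derive1_comp (Dg (- y)) Dn.
  by rewrite mulrN1.
- move=> y /andP[y0 _]; rewrite oppr_ge0 -h0.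
  by apply: (derive_ge0_le (f := h) (df := dh)) => //; lra.
Qed.

End real_inequalities.

Section logarithms.
Context {R : realType}.
Implicit Types (n T j : nat) (x y p s t : R).

Lemma ln_nat_ge0 n : 0 <= ln (n%:R : R).
Proof. by case: n => [|n]; [rewrite ln0|rewrite ln_ge0// ler1n]. Qed.

Lemma expR_ln_nat n : (0 < n)%N -> expR (ln (n%:R : R)) = n%:R.
Proof. by move=> n0; rewrite lnK// posrE ltr0n. Qed.

(** A discrete integral comparison: with [a n] equal to n^(-s), every term after the first is at
    most [s^-1] times the decrement of [a], and these telescope. *)
Lemma sum_inv_power_le s T : 0 < s ->
  \sum_(1 <= n < T) expR (- ((1 + s) * ln (n%:R : R))) <= 1 + s^-1.
Proof.
move=> s0; pose a n : R := expR (- (s * ln n%:R)).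
have step n : (0 < n)%N ->
    expR (- ((1 + s) * ln (n.+1%:R : R))) <= s^-1 * (a n - a n.+1).
  move=> n0; have n1 : (0 : R) < n.+1%:R by rewrite ltr0n.
  have nR : (0 : R) < n%:R by rewrite ltr0n.
  have -> : a n = a n.+1 * expR (s * (ln n.+1%:R - ln n%:R)).
    by rewrite /a -expRD; congr expR; ring.
  have -> : expR (- ((1 + s) * ln (n.+1%:R : R))) = a n.+1 * n.+1%:R^-1.
    rewrite mulrDl mul1r opprD expRD mulrC; congr (_ * _).
    by rewrite expRN expR_ln_nat.
  rewrite -[X in _ * (_ - X)]mulr1 -mulrBr mulrCA ler_wpM2l ?expR_ge0//.
  rewrite ler_pdivlMl//.
  have h := expR_ge1Dx (s * (ln n.+1%:R - ln (n%:R : R))).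
  have : n.+1%:R^-1 <= ln n.+1%:R - ln (n%:R : R).
    rewrite -ln_div ?posrE// -[leRHS]opprK -lnV ?posrE ?divr_gt0// invf_div.
    rewrite lerNr.
    have -> : n%:R / n.+1%:R = 1 + - (n.+1%:R)^-1 :> R.
      rewrite -[in LHS](_ : n.+1%:R - 1 = n%:R :> R); last by rewrite -natr1; ring.
      by field; rewrite gt_eqF.
    by apply: le_ln1Dx; rewrite ltrN2 invf_lt1 ?ltr1n.
  by move=> h1; apply: (le_trans (ler_wpM2l (ltW s0) h1)); rewrite lerBrDl.
have sum n : (0 < n)%N ->
    \sum_(1 <= i < n.+1) expR (- ((1 + s) * ln (i%:R : R)))
      <= 1 + s^-1 * (1 - a n).
  elim: n => // -[_ _|n IH _].
    by rewrite big_nat1 /a ln1 !mulr0 oppr0 expR0 subrr mulr0 addr0.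
  rewrite big_nat_recr//=; have := IH isT; have := step n.+1 isT.
  lra.
have s0' : 0 <= s^-1 by rewrite invr_ge0 ltW.
case: T => [|[|T]]; [by rewrite big_geq// addr_ge0..|].
apply: (le_trans (sum T.+1 isT)); rewrite lerD2l ler_piMr// lerBlDr lerDl.
exact: expR_ge0.
Qed.

Lemma ln_le_expR s x : 0 < s -> ln x <= s^-1 * expR (s * ln x).
Proof.
move=> s0; rewrite ler_pdivlMl//; have := expR_ge1Dx (s * ln x); lra.
Qed.

Lemma ln_nat_cube n : ln (n%:R : R) ^+ 3 <= 6 * n%:R.
Proof.
case: n => [|n]; first by rewrite ln0// expr0n mulr0.
have := @expR_ge1Dxn R (ln n.+1%:R) 2 (ln_nat_ge0 _).
by rewrite expR_ln_nat// (_ : 3`!%:R = 6)//; lra.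
Qed.

Lemma ln_nat_sqr n : ln (n%:R : R) ^+ 2 <= 2 * n%:R.
Proof.
case: n => [|n]; first by rewrite ln0// expr0n mulr0.
have := @expR_ge1Dxn R (ln n.+1%:R) 1 (ln_nat_ge0 _).
by rewrite expR_ln_nat// (_ : 2`!%:R = 2)//; lra.
Qed.

Lemma ln_nat_ge_half n : (1 < n)%N -> 1 / 2 <= ln (n%:R : R).
Proof.
move=> n1; have n0 : (0 : R) < n%:R by rewrite ltr0n ltnW.
have n2 : (2 : R) <= n%:R by rewrite ler_nat.
have := @le_ln1Dx R (n%:R^-1 - 1); rewrite addrCA subrr addr0 lnV ?posrE//.
have i0 : 0 < n%:R^-1 :> R by rewrite invr_gt0.
have : n%:R^-1 <= 2^-1 :> R by rewrite lef_pV2 ?posrE.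
move=> i2 /(_ _); lra.
Qed.

(** [10 <= n%:R * e] makes 1/n at most e/10, so that rounding to a grid of mesh 1/n is cheap;
    [e <= 1 / 20] keeps the tilt 6 e inside the range of the cubic expansion. *)
Lemma conf_radius_eventually (g : R) : 1 < g -> exists n0 : nat, forall n,
  (n0 <= n)%N -> let e := Num.sqrt (g * ln n%:R / (2 * n%:R)) in
  [/\ (0 < n)%N, e <= 1 / 20 & 10 <= n%:R * e].
Proof.
(* If e > 1/20, then [ln_nat_sqr] forces n < 80000 g^2, below (300 g)^2. If n e < 10, then n g ln n
   < 200, impossible for n >= 400 and ln n >= 1/2. *)
move=> g1; exists (maxn 400 (Num.bound ((g * 300) ^+ 2))) => n.
rewrite geq_max => /andP[n400 nb] /=.
have n0 : (0 < n)%N by exact: leq_trans n400.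
have n0R : (0 : R) < n%:R by rewrite ltr0n.
have n400R : (400 : R) <= n%:R by rewrite (ler_nat _ 400).
have gn : (g * 300) ^+ 2 <= n%:R.
  apply: le_trans (_ : (Num.bound ((g * 300) ^+ 2))%:R <= _); last by rewrite ler_nat.
  by apply/ltW/archi_boundP; rewrite sqr_ge0.
have L0 := ln_nat_ge0 n; have L2 := ln_nat_sqr n.
have Lh := ln_nat_ge_half (leq_trans (isT : (1 < 400)%N) n400).
set L := ln n%:R in L0 L2 Lh *; set e := Num.sqrt _.
have r0 : 0 <= g * L / (2 * n%:R) by rewrite divr_ge0// mulr_ge0//; lra.
have e2 : e ^+ 2 = g * L / (2 * n%:R) by rewrite sqr_sqrtr.
have e0 : 0 <= e by exact: sqrtr_ge0.
have ne2 : n%:R * e ^+ 2 = g * L / 2.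
  by rewrite e2; field; rewrite gt_eqF.
split=> //.
- rewrite leNgt; apply/negP => e20.
  have e2l : 1 / 400 < e ^+ 2.
    by rewrite (_ : 1 / 400 = (1/20) ^+ 2); [rewrite ltr_pXn2r ?nnegrE//; lra|field].
  have gL : n%:R / 200 < g * L by nra.
  have h1 : (n%:R / 200) ^+ 2 < (g * L) ^+ 2.
    by rewrite ltr_pXn2r ?nnegrE ?divr_ge0 ?mulr_ge0//; lra.
  have h2 : (g * L) ^+ 2 <= g ^+ 2 * (2 * n%:R).
    by rewrite exprMn ler_wpM2l ?sqr_ge0.
  nra.
- rewrite leNgt; apply/negP => ne.
  have : (n%:R * e) ^+ 2 < 10 ^+ 2.
    by rewrite ltr_pXn2r ?nnegrE// mulr_ge0// ltW.
  rewrite exprMn expr2 -mulrA ne2; nra.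
Qed.

Lemma exists_geometric_scale (b r : R) : 1 < b -> 1 <= r ->
  exists2 j : nat, b ^+ j <= r < b ^+ j.+1 & j%:R <= ln r / ln b.
Proof.
move=> b1 r1; have lb : 0 < ln b by rewrite ln_gt0.
have lr : 0 <= ln r by rewrite ln_ge0.
have b0 : 0 < b by lra.
exists (Num.truncn (ln r / ln b)); last by rewrite truncn_le// divr_ge0// ltW.
have /andP[j1 j2] := truncn_itv (divr_ge0 lr (ltW lb)).
rewrite ler_pdivlMr// in j1; rewrite ltr_pdivrMr// in j2.
have r0 : 0 < r by lra.
have bX k : b ^+ k = expR (k%:R * ln b) by rewrite expRM_natl lnK ?posrE.
apply/andP; split.
  by rewrite bX -[leRHS]lnK ?posrE// ler_expR.
by rewrite bX -[ltLHS]lnK ?posrE// ltr_expR.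
Qed.

End logarithms.

(** * Independence of the past *)

Section independence.
Context {R : realType}.
Local Open Scope ereal_scope.

(** Independence on rectangles makes the law of the pair the product of the laws, by uniqueness of
    the product measure; Tonelli then integrates over [Y] first. The target of [X] is kept abstract
    because it will be the sample space with a coarser sigma-algebra. *)
Lemma indep_integral d d1 d2 (T : measurableType d) (T1 : measurableType d1)
    (T2 : measurableType d2) (P : probability T R) (X : T -> T1) (Y : T -> T2)
    (f : T1 * T2 -> \bar R) :
  measurable_fun setT X -> measurable_fun setT Y ->
  (forall A B, measurable A -> measurable B ->
    P (X @^-1` A `&` Y @^-1` B) = P (X @^-1` A) * P (Y @^-1` B)) ->
  measurable_fun setT f -> (forall z, 0 <= f z) ->
  \int[P]_w f (X w, Y w) = \int[P]_w \int[P]_u f (X w, Y u).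
Proof.
move=> mX mY ind mf f0.
pose Xm : {mfun T >-> T1} := HB.pack X (isMeasurableFun.Build _ _ _ _ X mX).
pose Ym : {mfun T >-> T2} := HB.pack Y (isMeasurableFun.Build _ _ _ _ Y mY).
have mZ : measurable_fun setT (fun w => (X w, Y w)).
  exact: measurable_fun_pair.
pose Zm : {mfun T >-> (T1 * T2)%type} :=
  HB.pack (fun w => (X w, Y w)) (isMeasurableFun.Build _ _ _ _ _ mZ).
pose PX := distribution P Xm; pose PY := distribution P Ym.
pose PZ := distribution P Zm.
have PZE A : measurable A -> (PX \x PY) A = PZ A.
  by apply: product_measure_unique => B C mB mC; exact: ind.
transitivity (\int[PZ]_z f z).
  by rewrite ge0_integral_pushforward.
transitivity (\int[PX \x PY]_z f z).
  by apply: eq_measure_integral => A mA _; rewrite -[LHS]PZE.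
rewrite fubini_tonelli1//.
rewrite ge0_integral_pushforward//; last 2 first.
- exact: measurable_fun_fubini_tonelli_F.
- by move=> x _; exact: integral_ge0.
apply: eq_integral => w _ /=.
rewrite /fubini_F ge0_integral_pushforward//.
by apply/measurableT_comp => //; exact: measurable_pair1.
Qed.

Context d (T : measurableType d) (P : probability T R) (I : choiceType).
Variable X : I -> T -> R.

(** The pi-system on which [mutually_independent] yields product formulas. *)
Definition cylinders (D : set I) : set (set T) :=
  [set C | exists J A, [/\ uniq J, (forall i, i \in J -> D i),
    (forall i, measurable (A i)) &
    C = \bigcap_(i in [set` J]) (X i @^-1` (A i : set R))] ].

Lemma cylinders_setI D : setI_closed (cylinders D).
Proof.
move=> _ _ [J [A [uJ JD mA ->]]] [J' [A' [uJ' JD' mA' ->]]].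
exists (undup (J ++ J')), (fun i => (if i \in J then A i else setT) `&`
  (if i \in J' then A' i else setT)); split.
- exact: undup_uniq.
- by move=> i; rewrite mem_undup mem_cat => /orP[/JD|/JD'].
- by move=> i; apply: measurableI; case: ifP.
apply/seteqP; split=> w /=.
  move=> [h h'] i _ /=; split; case: ifP => // iJ; [exact: h|exact: h'].
move=> h; split=> i /= iJ.
  have /h[/=] : [set` undup (J ++ J')] i by rewrite /= mem_undup mem_cat iJ.
  by rewrite iJ.
have /h[/=] : [set` undup (J ++ J')] i by rewrite /= mem_undup mem_cat iJ orbT.
by rewrite iJ.
Qed.

Lemma cylinders_setT D : cylinders D setT.
Proof.
exists [::], (fun=> setT); split => //.
by apply/seteqP; split=> // w _ i.
Qed.

Lemma cylinders_preimage D i A : D i -> measurable A ->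
  cylinders D (X i @^-1` A).
Proof.
move=> Di mA; exists [:: i], (fun=> A); split => //.
  by move=> j; rewrite inE => /eqP ->.
apply/seteqP; split=> w /=; last by move=> /(_ i); apply; rewrite /= inE.
by move=> h j /=; rewrite inE => /eqP ->.
Qed.

(** The same sample points with the sigma-algebra generated by the variables indexed by [D]:
    measurability on [history D] is adaptedness. *)
Definition history D := g_sigma_algebraType (cylinders D).

Lemma measurable_history D i : D i ->
  measurable_fun setT (X i : history D -> R).
Proof.
move=> Di _ A mA; rewrite setTI; apply: sub_sigma_algebra.
exact: cylinders_preimage.
Qed.

Hypothesis mX : forall i, measurable_fun setT (X i).

Lemma cylinders_measurable D : cylinders D `<=` measurable.
Proof.
move=> _ [J [A [_ _ mA ->]]]; apply: fin_bigcap_measurable.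
  exact: finite_seq.
move=> i _; rewrite -[_ @^-1` _]setTI; exact: mX.
Qed.

Lemma measurable_id_history D : measurable_fun setT (id : T -> history D).
Proof.
move=> _ A mA; rewrite setTI preimage_id.
by apply: (smallest_sub (@sigma_algebra_measurable _ T) _ mA);
  exact: cylinders_measurable.
Qed.

(** Both sides are finite measures in [A] and agree on the pi-system of cylinders, hence on the
    sigma-algebra it generates. *)
Lemma history_indep (D0 D : set I) j : mutually_independent P D0 X ->
  D `<=` D0 -> D0 j -> ~ D j ->
  forall (A : set T) (B : set R), <<s cylinders D >> A -> measurable B ->
  P (A `&` X j @^-1` B) = P A * P (X j @^-1` B).
Proof.
move=> ind DD0 D0j Dj A B sA mB.
have mXB : measurable (X j @^-1` B) by rewrite -[_ @^-1` _]setTI; exact: mX.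
have fP : P (X j @^-1` B) \is a fin_num by exact: fin_num_measure.
have p0 : (0 <= fine (P (X j @^-1` B)))%R by exact: fine_ge0.
pose m1 := mrestr P mXB; pose m2 := mscale (NngNum p0) P.
have m2E C : m2 C = P C * P (X j @^-1` B).
  by rewrite /m2 /mscale/= fineK// muleC.
rewrite -m2E -[LHS]/(m1 A).
apply: (g_sigma_algebra_measure_unique (cylinders D) _ (fun=> setT)) sA.
- exact: cylinders_measurable.
- by move=> _; exact: cylinders_setT.
- by apply/seteqP; split=> // w _; exists 0%N.
- exact: cylinders_setI.
- move=> _ [J [A' [uJ JD mA' ->]]].
  rewrite [RHS]m2E.
  have jJ : j \notin J by apply/negP => /JD.
  have CE : \bigcap_(i in [set` J]) X i @^-1` A' i `&` X j @^-1` B =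
    \bigcap_(i in [set` j :: J]) X i @^-1` (if i == j then B else A' i).
    apply/seteqP; split=> w /=.
      move=> [h hj] i /=; rewrite inE.
      by case: (eqVneq i j) => [->//|_ /= iJ]; exact: h.
    move=> h; split; last by have := h j; rewrite /= inE eqxx; apply.
    move=> i /= iJ; have /h : [set` j :: J] i by rewrite /= inE iJ orbT.
    by case: (eqVneq i j) => // ij; rewrite -ij iJ in jJ.
  transitivity (P (\bigcap_(i in [set` j :: J])
      X i @^-1` (if i == j then B else A' i))); first exact: (congr1 (fun C => P C) CE).
  rewrite [X in _ = X * _]ind//; last by move=> i /JD/DD0.
  rewrite ind/=; last 3 first.
  + by rewrite /= jJ.
  + by move=> i; rewrite inE => /predU1P[->//|/JD/DD0].
  + by move=> i; case: ifP.
  rewrite big_cons eqxx muleC; congr (_ * _); apply: eq_big_seq => i iJ.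
  by case: (eqVneq i j) => // ij; rewrite -ij iJ in jJ.
- move=> _; apply: (@le_lt_trans _ _ 1); last exact: ltry.
  by apply: probability_le1; exact: measurableI.
Qed.

(** The freezing principle. The past enters as the identity map into [history D], so [f] may depend
    on the whole sample point as long as it does so measurably in the past. *)
Lemma history_integral (D0 D : set I) j (f : history D * R -> \bar R) :
  mutually_independent P D0 X ->
  D `<=` D0 -> D0 j -> ~ D j ->
  measurable_fun setT f -> (forall z, 0 <= f z) ->
  \int[P]_w f (w, X j w) = \int[P]_w \int[P]_u f (w, X j u).
Proof.
move=> ind DD0 D0j Dj mf f0.
apply: (indep_integral (X := id : T -> history D)) => //.
- exact: measurable_id_history.
- by move=> A B mA mB; exact: (history_indep ind DD0).
Qed.

End independence.

(** * Pathwise analysis of the algorithm *)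

Section algorithm.
Context {R : realType}.
Implicit Types (gamma a b x y : R) (vs ms : nat -> R) (n s t : nat).

Definition win gamma vs ms s : bool := ms s <= bid gamma vs ms s.

Definition nwins gamma vs ms n : R :=
  \sum_(1 <= s < n.+1) (win gamma vs ms s)%:R.

Definition vhat gamma vs ms n : R :=
  (\sum_(1 <= s < n.+1) vs s * (win gamma vs ms s)%:R) / nwins gamma vs ms n.

Definition radius gamma vs ms n : R :=
  Num.sqrt (gamma * ln (n%:R : R) / (2 * nwins gamma vs ms n)).

Definition fhat ms n b : R := (\sum_(1 <= s < n.+1) (ms s < b)%R%:R) / n%:R.

(** The right limit of [fhat] at b: it counts ties, as the true cdf and the winning rule do. *)
Definition fhat_right ms n b : R :=
  (\sum_(1 <= s < n.+1) (ms s <= b)%R%:R) / n%:R.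

Definition uhat gamma vs ms n b : R := (vhat gamma vs ms n - b) * fhat ms n b.

Definition uhat_max gamma vs ms n : R :=
  sup [set uhat gamma vs ms n b | b in [set b : R | 0 <= b <= 1]].

Definition bid_set gamma vs ms n : set R :=
  [set b : R | 0 <= b <= 1 /\ b <= vhat gamma vs ms n + radius gamma vs ms n /\
    uhat_max gamma vs ms n - 2 * radius gamma vs ms n
      <= uhat gamma vs ms n b].

Lemma size_bids gamma vs ms n : size (bids gamma vs ms n) = n.
Proof. by elim: n => //= n IH; rewrite size_rcons IH. Qed.

Lemma nth_bids gamma vs ms n s : (s < n)%N ->
  nth 0 (bids gamma vs ms n) s = bid gamma vs ms s.+1.
Proof.
elim: n => // n IH; rewrite ltnS leq_eqVlt => /predU1P[->//|sn].
by rewrite -IH//= nth_rcons size_bids sn.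
Qed.

Lemma bid1 gamma vs ms : bid gamma vs ms 1 = 1.
Proof. by []. Qed.

Lemma bidS gamma vs ms n : (0 < n)%N ->
  bid gamma vs ms n.+1 = sup (bid_set gamma vs ms n).
Proof.
move=> n0; rewrite /bid/= nth_rcons size_bids ltnn eqxx /next_bid size_bids.
rewrite gtn_eqF//.
have nE s : (1 <= s < n.+1)%N ->
    nth 0 (bids gamma vs ms n) s.-1 = bid gamma vs ms s.
  by case: s => // s /andP[_ sn]; rewrite nth_bids.
have NE : \sum_(1 <= s < n.+1) (ms s <= nth 0 (bids gamma vs ms n) s.-1)%R%:R
    = nwins gamma vs ms n.
  by apply: eq_big_nat => s /nE ->.
have VE : \sum_(1 <= s < n.+1)
      vs s * (ms s <= nth 0 (bids gamma vs ms n) s.-1)%R%:R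
    = \sum_(1 <= s < n.+1) vs s * (win gamma vs ms s)%:R.
  by apply: eq_big_nat => s /nE ->.
by rewrite NE VE.
Qed.

Lemma bid_itv gamma vs ms n : 0 <= bid gamma vs ms n.+1 <= 1.
Proof.
case: n => [|n]; first by rewrite bid1 ler01 lexx.
(* An empty [bid_set] would produce the default value [sup set0 = 0], which lies in the interval. *)
rewrite bidS//; have [->|/set0P[b bS]] := eqVneq (bid_set gamma vs ms n.+1) set0.
  by rewrite sup0 lexx ler01.
have ub1 : ubound (bid_set gamma vs ms n.+1) 1 by move=> c [/andP[]].
apply/andP; split; last by apply: ge_sup => //; exists b.
apply: le_trans (_ : b <= _); first by case: bS => /andP[].
by apply: ub_le_sup => //; exists 1.
Qed.

Section data.
Variables (gamma : R) (vs ms : nat -> R).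
Hypothesis vs01 : forall s, (1 <= s)%N -> 0 <= vs s <= 1.
Hypothesis ms01 : forall s, (1 <= s)%N -> 0 <= ms s <= 1.
Local Notation win := (win gamma vs ms).
Local Notation N := (nwins gamma vs ms).
Local Notation Vh := (vhat gamma vs ms).
Local Notation eps := (radius gamma vs ms).
Local Notation Fh := (fhat ms).
Local Notation Fr := (fhat_right ms).
Local Notation Uh := (uhat gamma vs ms).
Local Notation Um := (uhat_max gamma vs ms).
Local Notation S := (bid_set gamma vs ms).

Lemma nwinsS n : N n.+1 = N n + (win n.+1)%:R.
Proof. by rewrite /nwins big_nat_recr. Qed.

(** The opening bid 1 wins round 1, so divisions by [N n] are genuine from then on. *)
Lemma nwins_ge1 n : (0 < n)%N -> 1 <= N n.
Proof.
case: n => // n _; rewrite /nwins big_nat_recl//=.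
have -> : win 1%N = true by have /andP[_] := ms01 (leqnn 1).
by rewrite lerDl sumr_ge0.
Qed.

Lemma nwins_le n : N n <= n%:R.
Proof.
rewrite /nwins (_ : n%:R = \sum_(1 <= s < n.+1) 1); last by rewrite sumr_const_nat subn1.
by apply: ler_sum => s _; case: (win s).
Qed.

Lemma nwins_ge0 n : 0 <= N n.
Proof. by apply: sumr_ge0. Qed.

Lemma vhat_ge0 n : 0 <= Vh n.
Proof.
rewrite divr_ge0 ?nwins_ge0// big_nat sumr_ge0// => s /andP[s1 _].
by rewrite mulr_ge0//; have /andP[] := vs01 s1.
Qed.

Lemma vhat_le1 n : (0 < n)%N -> Vh n <= 1.
Proof.
move=> n0; have N1 := nwins_ge1 n0; rewrite ler_pdivrMr ?mul1r; last lra.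
rewrite /nwins !big_nat; apply: ler_sum => s /andP[s1 _].
by rewrite ler_piMl//; have /andP[] := vs01 s1.
Qed.

Lemma fhat_ge0 n b : 0 <= Fh n b.
Proof. by rewrite divr_ge0// sumr_ge0. Qed.

Lemma mean_le1 n (h : nat -> bool) :
  (\sum_(1 <= s < n.+1) (h s)%:R) / n%:R <= 1 :> R.
Proof.
case: n => [|n]; first by rewrite invr0 mulr0.
rewrite ler_pdivrMr ?ltr0n// mul1r.
rewrite (_ : n.+1%:R = \sum_(1 <= s < n.+2) 1); last by rewrite sumr_const_nat subn1.
by apply: ler_sum => s _; case: (h s).
Qed.

Lemma fhat_le1 n b : Fh n b <= 1. Proof. exact: mean_le1. Qed.

Lemma fhat_right_le1 n b : Fr n b <= 1. Proof. exact: mean_le1. Qed.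

Lemma fhat_right_ge0 n b : 0 <= Fr n b.
Proof. by rewrite divr_ge0// sumr_ge0. Qed.

Lemma fhat_le n x y : x <= y -> Fh n x <= Fh n y.
Proof.
move=> xy; rewrite ler_wpM2r ?invr_ge0// ler_sum// => s _.
by rewrite ler_nat; case: (ltP (ms s) x) => // /lt_le_trans ->.
Qed.

Lemma fhat_le_right n x y : x <= y -> Fh n x <= Fr n y.
Proof.
move=> xy; rewrite ler_wpM2r ?invr_ge0// ler_sum// => s _.
by rewrite ler_nat; case: (ltP (ms s) x) => // /ltW/le_trans ->.
Qed.

Lemma fhat_right_le n x y : x < y -> Fr n x <= Fh n y.
Proof.
move=> xy; rewrite ler_wpM2r ?invr_ge0// ler_sum// => s _.
by rewrite ler_nat; case: (leP (ms s) x) => // /le_lt_trans ->.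
Qed.

(** Strict inequalities make [fhat] a left-continuous step function. This is what lets suprema of
    bids be attained and bids be replaced by rationals on their left. *)
Lemma fhat_left_gap n b : 0 < b ->
  exists2 y, 0 <= y < b & forall x, y <= x <= b -> Fh n x = Fh n b.
Proof.
move=> b0.
have [y yb yP] : exists2 y, 0 <= y < b &
    forall s, (1 <= s < n.+1)%N -> ms s < b -> ms s < y.
  elim: n => [|n [y /andP[y0 yb] yP]]; first by exists 0; [rewrite lexx|case].
  have [mb|bm] := ltP (ms n.+1) b; last first.
    exists y; rewrite ?y0// => s /andP[s1]; rewrite ltnS leq_eqVlt.
    by move=> /predU1P[->|sn]; [rewrite ltNge bm|apply: yP; rewrite s1].
  exists (Num.max y ((ms n.+1 + b) / 2)).
    by rewrite le_max y0/= gt_max yb/=; lra.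
  move=> s /andP[s1]; rewrite ltnS leq_eqVlt lt_max => /predU1P[-> _|sn msb].
    by apply/orP; right; lra.
  by rewrite yP// s1.
exists y => // x /andP[yx xb]; congr (_ / _); apply: eq_big_nat => s sn.
congr (nat_of_bool _)%:R; apply/idP/idP => [msx|/(yP _ sn) msy].
  exact: lt_le_trans msx xb.
exact: lt_le_trans msy yx.
Qed.

Lemma fhat_right_gap n b :
  exists2 y, b < y & forall x, b < x <= y -> Fh n x = Fr n b.
Proof.
have [y yb yP] : exists2 y, b < y &
    forall s, (1 <= s < n.+1)%N -> b < ms s -> y <= ms s.
  elim: n => [|n [y yb yP]]; first by exists (b + 1); [rewrite ltrDl|case].
  have [mb|bm] := leP (ms n.+1) b.
    exists y => // s /andP[s1]; rewrite ltnS leq_eqVlt.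
    by move=> /predU1P[->|sn]; [rewrite ltNge mb|apply: yP; rewrite s1].
  exists (Num.min y (ms n.+1)); first by rewrite lt_min yb.
  move=> s /andP[s1]; rewrite ltnS leq_eqVlt ge_min => /predU1P[-> _|sn msb].
    by rewrite lexx orbT.
  by rewrite yP// s1.
exists y => // x /andP[bx xy]; congr (_ / _); apply: eq_big_nat => s sn.
congr (nat_of_bool _)%:R; apply/idP/idP => [msx|/le_lt_trans->//].
by rewrite leNgt; apply/negP => /(yP _ sn)/(le_trans xy); rewrite leNgt msx.
Qed.

Lemma uhat_le1 n b : (0 < n)%N -> 0 <= b -> Uh n b <= 1.
Proof.
move=> n0 b0; have := fhat_le1 n b; have := fhat_ge0 n b.
have := vhat_le1 n0; rewrite /uhat; nra.
Qed.

Lemma uhat0_ge0 n : 0 <= Uh n 0.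
Proof. by rewrite /uhat subr0 mulr_ge0 ?vhat_ge0 ?fhat_ge0. Qed.

Lemma uhat_has_sup n : (0 < n)%N ->
  has_sup [set Uh n b | b in [set b : R | 0 <= b <= 1]].
Proof.
move=> n0; split; first by exists (Uh n 0), 0 => //=; rewrite lexx ler01.
by exists 1 => _ [b /andP[b0 _] <-]; exact: uhat_le1.
Qed.

Lemma uhat_le_max n b : (0 < n)%N -> 0 <= b <= 1 -> Uh n b <= Um n.
Proof.
move=> n0 b01; apply: ub_le_sup; first by case: (uhat_has_sup n0).
by exists b.
Qed.

Lemma bid_set_has_ubound n : has_ubound (S n).
Proof. by exists 1 => b [/andP[]]. Qed.

(** The positive slack admits a near-maximiser of the empirical utility. If it exceeds the cap
    [Vh n + eps n], its utility is at most 0, and the bid 0 does as well. *)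
Lemma bid_set_neq0 n : (0 < n)%N -> 0 < eps n -> S n !=set0.
Proof.
move=> n0 e0.
have [_ [b b01 <-] ub] : exists2 u,
    [set Uh n b | b in [set b : R | 0 <= b <= 1]] u & Um n - 2 * eps n < u.
  by apply: sup_gt; [case: (uhat_has_sup n0)|rewrite ltrBlDr ltrDl mulr_gt0].
have [bV|Vb] := leP b (Vh n + eps n); first by exists b; split=> //; split => //; exact: ltW.
exists 0; split; first by rewrite lexx ler01.
have V0 := vhat_ge0 n; split; first by lra.
apply: (le_trans (ltW ub)); apply: (@le_trans _ _ 0); last exact: uhat0_ge0.
by rewrite /uhat mulr_le0_ge0 ?fhat_ge0//; lra.
Qed.

(** The supremum is attained: [fhat] is constant just left of it, so there the empirical utility
    varies with slope at most 1. *)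
Lemma bid_in_set n : (0 < n)%N -> 0 < eps n -> S n (bid gamma vs ms n.+1).
Proof.
move=> n0 e0; rewrite bidS//; set B := sup _.
have S0 := bid_set_neq0 n0 e0; have Sub := bid_set_has_ubound n.
have B01 : 0 <= B <= 1 by have := bid_itv gamma vs ms n; rewrite bidS.
split=> //; split; first by apply: ge_sup => // b [_ []].
have [B0|B0] := leP B 0.
  have [c cS] := S0; have cB : c <= B by exact: ub_le_sup.
  suff -> : B = c by case: cS => _ [].
  by move: cS => [/andP[c0 _] _]; apply/eqP; rewrite eq_le cB andbT (le_trans B0).
rewrite leNgt; apply/negP => UB.
have [y /andP[y0 yB] yP] := fhat_left_gap n B0.
(* The amount by which the supremum B would miss the constraint. A member c within e of B and on the
   same step of [fhat] differs from B by less than e in utility, a contradiction. *)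
set e := Um n - 2 * eps n - Uh n B.
have [c cS] : exists2 c, S n c & Num.max y (B - e) < c.
  by apply: sup_gt => //; rewrite gt_max yB/= ltrBlDr ltrDl subr_gt0.
rewrite gt_max => /andP[yc Bec].
have cB : c <= B by exact: ub_le_sup.
have Fc : Fh n c = Fh n B by apply: yP; rewrite (ltW yc).
have [_ [_]] := cS; rewrite /uhat Fc => cU.
have := fhat_ge0 n B; have := fhat_le1 n B; move: Bec cU.
by rewrite /e /uhat; nra.
Qed.

(** The left side is the limit of the utilities of bids decreasing to b, for which [b < 1] leaves
    room. *)
Lemma uhat_right_le_max n b : (0 < n)%N -> 0 <= b < 1 ->
  (Vh n - b) * Fr n b <= Um n.
Proof.
move=> n0 /andP[b0 b1]; rewrite leNgt; apply/negP => UG.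
have [y yb yP] := fhat_right_gap n b.
set e := (Vh n - b) * Fr n b - Um n.
have e0 : 0 < e by rewrite subr_gt0.
pose x := Num.min y (Num.min 1 (b + e / 2)).
have bx : b < x by rewrite !lt_min yb b1/= ltrDl divr_gt0.
have x1 : x <= 1 by rewrite !ge_min lexx orbT.
have xe : x <= b + e / 2 by rewrite !ge_min lexx !orbT.
have xy : x <= y by rewrite ge_min lexx.
have : Uh n x <= Um n by apply: uhat_le_max => //; rewrite x1 andbT; lra.
rewrite /uhat yP ?bx//.
have := fhat_right_ge0 n b; have := fhat_right_le1 n b.
by move: xe; rewrite /e; nra.
Qed.

(** If the bid were below b, no member of [S n] would be at or above b. Then the maximum of the
    empirical utility is controlled by its values on [0, b], hence by the right limit at b plus 2
    eps - d, and a point within d to the right of b belongs to [S n] after all. *)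
Lemma bid_ge n b (d : R) : (0 < n)%N -> 0 < eps n -> 0 < d ->
  0 <= b < 1 -> b < Vh n + eps n ->
  0 <= (Vh n - b) * Fr n b + 2 * eps n - d ->
  (forall x, 0 <= x <= b -> Uh n x <= (Vh n - b) * Fr n b + 2 * eps n - d) ->
  b <= bid gamma vs ms n.+1.
Proof.
move=> n0 e0 d0 /andP[b0 b1] bV G0 xG; set G := (Vh n - b) * Fr n b in G0 xG.
rewrite leNgt; apply/negP; rewrite bidS// => Bb.
have notS x : b <= x -> ~ S n x.
  move=> bx Sx; have := ub_le_sup (bid_set_has_ubound n) Sx.
  by rewrite leNgt (lt_le_trans Bb).
have UmG : Um n <= G + 2 * eps n - d.
  rewrite leNgt; apply/negP => UmG.
  (* The first entry of the maximum is below [Um n], so only the second can bound it. It covers bids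
     up to b and bids above the cap; the first covers the remaining ones, excluded from [S n]. *)
  suff : Um n <= Num.max (Um n - 2 * eps n) (G + 2 * eps n - d).
    by rewrite le_max => /orP[]; lra.
  apply: ge_sup; first by case: (uhat_has_sup n0).
  move=> _ [x /andP[x0 x1] <-]; rewrite le_max.
  have [xb|bx] := leP x b; first by rewrite xG ?orbT// x0.
  have [xV|Vx] := leP x (Vh n + eps n).
    apply/orP; left; rewrite leNgt; apply/negP => Ux.
    by apply: (notS x (ltW bx)); split; [rewrite x0|split => //; exact: ltW].
  apply/orP; right; apply: le_trans G0.
  by rewrite /uhat mulr_le0_ge0 ?fhat_ge0//; lra.
have [y yb yP] := fhat_right_gap n b.
pose x := Num.min (Num.min y (Vh n + eps n)) (Num.min 1 (b + d)).
have bx : b < x by rewrite !lt_min yb b1 bV/= ltrDl.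
have x1 : x <= 1 by rewrite !ge_min lexx !orbT.
have xe : x <= b + d by rewrite !ge_min lexx !orbT.
have xy : x <= y by rewrite !ge_min lexx.
have xV : x <= Vh n + eps n by rewrite !ge_min lexx orbT.
apply: (notS x (ltW bx)); split; first by rewrite x1 andbT; lra.
split => //; rewrite /uhat yP ?bx//.
have := fhat_right_ge0 n b; have := fhat_right_le1 n b.
by move: UmG; rewrite /G; nra.
Qed.

End data.
End algorithm.

(** * From good events to the regret of one round *)

Section pathwise_regret.
Context {R : realType}.
Variables (gamma : R) (vs ms : nat -> R).
Hypothesis vs01 : forall s, (1 <= s)%N -> 0 <= vs s <= 1.
Hypothesis ms01 : forall s, (1 <= s)%N -> 0 <= ms s <= 1.
Implicit Types (n : nat) (v b e tau : R).
Local Notation N := (nwins gamma vs ms).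
Local Notation Vh := (vhat gamma vs ms).
Local Notation eps := (radius gamma vs ms).
Local Notation Fh := (fhat ms).
Local Notation Fr := (fhat_right ms).
Local Notation Uh := (uhat gamma vs ms).
Local Notation Um := (uhat_max gamma vs ms).
Local Notation B n := (bid gamma vs ms n.+1).

(** On [0, b] the maximum of the empirical utility is compared with its right
    limit at [b] on the grid [min(b, k/n)]: rounding up to the grid costs [1/n]. *)
Lemma bid_ge_of_grid n v b e : (0 < n)%N -> e <= eps n -> 10 <= n%:R * e ->
  0 <= b < v -> v <= 1 -> `|Vh n - v| < eps n ->
  (forall k, (0 < k <= n)%N -> let g := Num.min b (k%:R / n%:R) in
    (v - g) * Fh n g - (v - b) * Fr n b + e * (Fr n b - Fh n g)
      <= 2 * e - 2 / n%:R) ->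
  b <= B n.
Proof.
move=> n0 ee ne /andP[b0 bv] v1; rewrite ltr_norml => /andP[V1 V2] grid.
have nR : (0 : R) < n%:R by rewrite ltr0n.
have i0 : (0 : R) < n%:R^-1 by rewrite invr_gt0.
have ie : n%:R^-1 <= e / 10.
  by rewrite -(ler_pM2l nR) divff ?gt_eqF//; lra.
have e0 : 0 < eps n by lra.
have Fr0 := fhat_right_ge0 ms n b; have Fr1 := fhat_right_le1 ms n b.
have Gge : - eps n <= (Vh n - b) * Fr n b by nra.
(* Of the slack 2/n in the grid condition, 1/n serves as room d to the right of b and 1/n pays for
   rounding x up to g. *)
apply: (bid_ge vs01 ms01 (d := n%:R^-1)) => //.
- by rewrite b0; lra.
- by lra.
- by lra.
move=> x /andP[x0 xb].
have xn : 0 <= x * n%:R by rewrite mulr_ge0// ltW.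
have /andP[k1 k2] := truncn_itv xn.
set k := (Num.truncn (x * n%:R)).+1 in k1 k2.
have kn : (0 < k <= n)%N.
  rewrite /= -(ltr_nat R); apply: (le_lt_trans k1).
  by rewrite -ltr_pdivlMr// divff ?gt_eqF//; lra.
have := grid k kn => /=; set g := Num.min b _ => gP.
have xg : x <= g by rewrite le_min xb/= ler_pdivlMr// ltW.
have gb : g <= b by rewrite ge_min lexx.
have gx : g <= x + n%:R^-1.
  rewrite ge_min; apply/orP; right; rewrite ler_pdivrMr// mulrDl mulVf ?gt_eqF//.
  by rewrite /k -natr1 lerD2r.
have F0 := fhat_ge0 ms n x; have F1 := fhat_le1 ms n x.
have G0 := fhat_ge0 ms n g; have G1 := fhat_le1 ms n g.
have Fxg := fhat_le ms n xg; have Fgb := fhat_le_right ms n gb.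
rewrite /uhat; have [gV|Vg] := leP g (Vh n); last first.
  apply: (@le_trans _ _ n%:R^-1); last lra.
  by nra.
have step1 : (Vh n - x) * Fh n x <= (Vh n - g) * Fh n g + n%:R^-1.
  have : (Vh n - x) * Fh n x <= (Vh n - x) * Fh n g by rewrite ler_wpM2l//; lra.
  have : (x + n%:R^-1 - g) * Fh n g >= 0 by rewrite mulr_ge0//; lra.
  by nra.
(* Replacing v by [Vh n] costs at most eps times the empirical mass of [g, b]; the e-term of the
   grid condition anticipates this, and [step3] passes from e to eps. *)
have step2 : (Vh n - v) * (Fh n g - Fr n b) <= eps n * (Fr n b - Fh n g).
  have : 0 <= (Vh n - v + eps n) * (Fr n b - Fh n g) by rewrite mulr_ge0; lra.
  by lra.
have step3 : (eps n - e) * (Fr n b - Fh n g) <= eps n - e.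
  by rewrite ler_piMr//; lra.
by lra.
Qed.

(** [A] stands for F(b) and [FB] for F(B). Writing q = FB - A, the regret is at most 4 eps (1 + q),
    and 1 + q <= (A + q) / A since A <= 1. The budget in the worse case B > v is 2 eps from the
    algorithm's slack, 3 eps q from the mass gained, tau <= 8/5 eps from the estimate at b, and 3
    eps tau <= 3/10 eps. *)
Lemma regret_le_radius n v b e tau (A FB : R) : (0 < n)%N ->
  0 < eps n -> e <= eps n ->
  0 <= b < v -> v <= 1 -> `|Vh n - v| < eps n -> b <= B n ->
  0 < A -> A <= FB -> FB <= 1 -> (B n = b -> FB = A) ->
  0 <= tau <= 1 / 10 -> tau <= 8 / 5 * e ->
  A - Fr n b <= tau -> (b < B n -> Fh n (B n) - Fr n b <= FB - A + tau) ->
  (v - b) * A - (v - B n) * FB <= 4 / A * (radius gamma vs ms n * FB).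
Proof.
move=> n0 e0 ee /andP[b0 bv] v1; rewrite ltr_norml => /andP[V1 V2] bB.
move=> A0 AFB FB1 FBA /andP[t0 t1] te Aa fa.
have [/andP[B0 B1] [BV UB]] := bid_in_set vs01 ms01 n0 e0.
have goal4 : 4 * eps n * (1 + (FB - A)) <= 4 / A * (eps n * FB).
  rewrite [leRHS](_ : _ = 4 * eps n * (FB / A)); last by field; rewrite gt_eqF.
  rewrite ler_wpM2l//; first lra.
  rewrite ler_pdivlMr//; have : 0 <= (FB - A) * (1 - A) by rewrite mulr_ge0; lra.
  by lra.
apply: le_trans goal4.
have [Bb|bB'] := leP (B n) b.
  have BE : B n = b by apply/eqP; rewrite eq_le Bb bB.
  have : 0 <= eps n * (1 + (FB - A)) by rewrite mulr_ge0//; lra.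
  by rewrite BE FBA//; lra.
have {}fa := fa bB'.
have G : (Vh n - b) * Fr n b <= Um n.
  by apply: (uhat_right_le_max gamma vs01 ms01 n0); rewrite b0; lra.
have aF : Fr n b <= Fh n (B n) by exact: fhat_right_le.
have f0 := fhat_ge0 ms n (B n); have f1 := fhat_le1 ms n (B n).
have a0 := fhat_right_ge0 ms n b; have a1 := fhat_right_le1 ms n b.
rewrite /uhat in UB.
set f := Fh n (B n) in UB aF f0 f1 fa; set a := Fr n b in G aF a0 a1 Aa fa.
set x := B n in UB BV B0 B1 bB' bB *.
set r := eps n in e0 ee V1 V2 BV UB *.
set w := Vh n in V1 V2 BV UB G.
have q0 : 0 <= FB - A by lra.
have rt : r * tau <= r / 10 by rewrite ler_wpM2l//; lra.
have rfa : r * (f - a) <= r * (FB - A + tau) by rewrite ler_wpM2l//; lra.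
have rq : 0 <= r * (FB - A) by rewrite mulr_ge0//; lra.
have UG : (w - b) * a - 2 * r <= (w - x) * f by lra.
have cross : (w - v) * (f - a) <= r * (f - a) by rewrite ler_wpM2r//; lra.
have bA : (v - b) * (A - a) <= tau.
  apply: (@le_trans _ _ ((v - b) * tau)); first by rewrite ler_wpM2l//; lra.
  by rewrite ler_piMl//; lra.
have [xv|vx] := leP x v.
  have h1 : (v - x) * (f - a - (FB - A)) <= (v - x) * tau.
    by rewrite ler_wpM2l//; lra.
  have h2 : (x - b) * (A - a) <= (x - b) * tau by rewrite ler_wpM2l//; lra.
  have h3 : (v - b) * tau <= tau by rewrite ler_piMl//; lra.
  by lra.
(* When the bid exceeds v, the cap and the confidence bound give x - v <= 2 r, so the error on the
   winning probability is damped by r. *)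
have h1 : (x - v) * (FB - f) <= 2 * r * (FB - A + tau).
  apply: (@le_trans _ _ ((x - v) * (FB - A + tau))).
    by rewrite ler_wpM2l//; lra.
  by rewrite ler_wpM2r//; lra.
by lra.
Qed.

Lemma sum_win_radius_le n : 0 <= gamma ->
  \sum_(1 <= s < n) radius gamma vs ms s * (win gamma vs ms s.+1)%:R
    <= Num.sqrt (gamma * ln n%:R / 2) * (2 * Num.sqrt n%:R).
Proof.
move=> g0; case: n => [|n]; first by rewrite big_geq// mulr_ge0 ?mulr_ge0 ?sqrtr_ge0.
pose c := Num.sqrt (gamma * ln (n.+1%:R : R) / 2).
have c0 : 0 <= c by exact: sqrtr_ge0.
(* The radius uses the count before the win it is multiplied with, and the win of round 1 is not in
   the sum; hence the shift by 1 under the root. *)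
have sumw m : \sum_(1 <= s < m.+1)
    (Num.sqrt (N s))^-1 * (win gamma vs ms s.+1)%:R
    <= 2 * Num.sqrt (N m.+1 - 1).
  elim: m => [|m IH]; first by rewrite big_geq// mulr_ge0 ?sqrtr_ge0.
  rewrite big_nat_recr//= [N m.+2]nwinsS.
  have N1 := nwins_ge1 gamma vs ms01 (ltn0Sn m).
  case: (win gamma vs ms m.+2); last by rewrite mulr0 !addr0.
  rewrite mulr1 addrK; apply: (le_trans (lerD IH (lexx _))).
  set p := Num.sqrt (N m.+1 - 1); set q := Num.sqrt (N m.+1).
  have q0 : 0 < q by rewrite sqrtr_gt0; lra.
  have p0 : 0 <= p by exact: sqrtr_ge0.
  have q2 : q ^+ 2 = N m.+1 by rewrite sqr_sqrtr//; lra.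
  have p2 : p ^+ 2 = N m.+1 - 1 by rewrite sqr_sqrtr//; lra.
  rewrite -(ler_pM2r q0) mulrDl mulVf ?gt_eqF//.
  by have := sqr_ge0 (q - p); nra.
apply: (@le_trans _ _ (c * \sum_(1 <= s < n.+1)
    (Num.sqrt (N s))^-1 * (win gamma vs ms s.+1)%:R)).
  rewrite mulr_sumr !big_nat; apply: ler_sum => s /andP[s1 sn].
  rewrite mulrA ler_wpM2r//.
  have N1 := nwins_ge1 gamma vs ms01 s1.
  have N0 : 0 < N s by lra.
  have lns : ln (s%:R : R) <= ln n.+1%:R.
    by rewrite ler_ln ?posrE ?ltr0n// ler_nat ltnW.
  rewrite /radius /c -sqrtrV ?(ltW N0)// -sqrtrM; last first.
    by rewrite !mulr_ge0// ln_nat_ge0.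
  rewrite ler_wsqrtr// invfM mulrA ler_wpM2r ?invr_ge0 ?(ltW N0)//.
  by rewrite ler_wpM2r// ler_wpM2l.
rewrite ler_wpM2l//; apply: (le_trans (sumw n)); rewrite ler_wpM2l//.
by rewrite ler_wsqrtr// (le_trans _ (nwins_le gamma vs ms _))// gerBl.
Qed.

End pathwise_regret.

(** * Measurability of the bids *)

Section bid_measurability.
Context {R : realType}.

Section rational_bids.
Variables (gamma : R) (vs ms : nat -> R).
Hypothesis vs01 : forall s, (1 <= s)%N -> 0 <= vs s <= 1.
Hypothesis ms01 : forall s, (1 <= s)%N -> 0 <= ms s <= 1.
Local Notation Uh := (uhat gamma vs ms).
Local Notation Um := (uhat_max gamma vs ms).
Local Notation S := (bid_set gamma vs ms).

(** Moving left on the same step of [fhat] lowers the payment without changing the empirical winning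
    probability. Thus suprema over real bids become countable unions over rationals, which are
    measurable. *)
Lemma exists_rat_uhat_ge n (b z : R) : 0 < b -> z < b -> exists q : rat,
  [/\ z < ratr q, 0 <= (ratr q : R), ratr q <= b & Uh n b <= Uh n (ratr q)].
Proof.
move=> b0 zb; have [y /andP[y0 yb] yP] := fhat_left_gap ms n b0.
have zyb : Num.max z y < b by rewrite gt_max zb.
have [q] := rat_in_itvoo zyb.
rewrite in_itv/= gt_max => /andP[/andP[zq yq] qb]; exists q; split => //.
- by rewrite ltW// (le_lt_trans y0).
- exact: ltW.
- rewrite /uhat yP ?(ltW yq) ?(ltW qb)// ler_wpM2r ?fhat_ge0// lerD2l lerN2.
  exact: ltW.
Qed.

Lemma uhat_max_gtP n (x : R) : (0 < n)%N -> x < Um n <->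
  exists q : rat, 0 <= (ratr q : R) <= 1 /\ x < Uh n (ratr q).
Proof.
move=> n0; split=> [xU|[q [q01 xq]]]; last first.
  exact: lt_le_trans xq (uhat_le_max gamma vs01 ms01 n0 q01).
have [_ [b /andP[b0 b1] <-] xb] := sup_gt (proj1 (uhat_has_sup gamma vs01 ms01 n0)) xU.
move: b0; rewrite le_eqVlt => /predU1P[bE|b0].
  by exists 0%Q; rewrite rmorph0 lexx ler01 bE.
have [q [_ q0 qb bq]] := exists_rat_uhat_ge n b0 b0.
by exists q; rewrite q0 (le_trans qb b1) (lt_le_trans xb bq).
Qed.

Lemma bid_gtP n (x : R) : (0 < n)%N -> 0 <= x -> x < bid gamma vs ms n.+1 <->
  exists q : rat, x < ratr q /\ S n (ratr q).
Proof.
move=> n0 x0; rewrite bidS//; split=> [xB|[q [xq Sq]]]; last first.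
  exact: lt_le_trans xq (ub_le_sup (bid_set_has_ubound _ _ _ _) Sq).
have S0 : S n !=set0.
  by apply/set0P/eqP => S0; move: xB; rewrite S0 sup0 ltNge x0.
have [b Sb xb] := sup_gt S0 xB.
have b0 : 0 < b by exact: le_lt_trans xb.
have [q [xq q0 qb bq]] := exists_rat_uhat_ge n b0 xb.
exists q; split => //; case: Sb => [/andP[_ b1] [bV Ub]]; split.
  by rewrite q0 (le_trans qb).
by split; [exact: le_trans bV|exact: le_trans bq].
Qed.

End rational_bids.

Lemma measurable_gtP d (T : measurableType d) (f : T -> R) :
  (forall x, measurable [set w | x < f w]) -> measurable_fun setT f.
Proof.
move=> mf mT; apply: (measurability _ (RGenOInfty.measurableE R)) => //.
move=> _ [_ [x ->] <-]; rewrite setTI.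
rewrite (_ : _ @^-1` _ = [set w | x < f w])//.
by apply/seteqP; split => w /=; rewrite in_itv/= andbT.
Qed.

Lemma measurable_lt_set d (T : measurableType d) (f g : T -> R) :
  measurable_fun setT f -> measurable_fun setT g ->
  measurable [set w | f w < g w].
Proof.
move=> mf mg; have := measurable_fun_ltr mf mg measurableT (Y := [set true]).
by rewrite setTI; apply.
Qed.

Lemma measurable_le_set d (T : measurableType d) (f g : T -> R) :
  measurable_fun setT f -> measurable_fun setT g ->
  measurable [set w | f w <= g w].
Proof.
move=> mf mg; have := measurable_fun_ler mf mg measurableT (Y := [set true]).
by rewrite setTI; apply.
Qed.

Lemma measurable_natr_bool d (T : measurableType d) (b : T -> bool) :
  measurable_fun setT b -> measurable_fun setT (fun w => (b w)%:R : R).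
Proof.
move=> mb; rewrite (_ : (fun w => _) = (fun w => if b w then 1 else 0)).
  exact: measurable_fun_ifT.
by apply/funext => w; case: (b w).
Qed.

Lemma measurable_sqrt : measurable_fun setT (@Num.sqrt R).
Proof.
apply: nondecreasing_measurable => // x y xy; exact: ler_wsqrtr.
Qed.

Lemma measurable_inv_ge0 d (T : measurableType d) (f : T -> R) :
  (forall w, 0 <= f w) -> measurable_fun setT f ->
  measurable_fun setT (fun w => (f w)^-1).
Proof.
move=> f0 mf; rewrite (_ : (fun w => _) = (fun w => (f w) `^ (-1))).
  by apply: (measurableT_comp (f := fun x => x `^ (-1))) => //; exact: measurable_powR.
by apply/funext => w; rewrite powR_inv1.
Qed.

Lemma measurable_sum_nat d (T : measurableType d) m n (h : nat -> T -> R) :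
  (forall s, (m <= s < n)%N -> measurable_fun setT (h s)) ->
  measurable_fun setT (fun w => \sum_(m <= s < n) h s w).
Proof.
move=> mh; pose h' s w := if (m <= s < n)%N then h s w else 0.
rewrite (_ : (fun w => _) = (fun w => \sum_(m <= s < n) h' s w)).
  apply: measurable_sum => s; rewrite /h'.
  by have [sn|/negbTE sn] := boolP (m <= s < n)%N; rewrite ?sn; [exact: mh|].
by apply/funext => w; apply: eq_big_nat => s; rewrite /h' => ->.
Qed.

Section process.
Context d (T : measurableType d) (gamma : R) (V M : nat -> T -> R).
Hypothesis V01 : forall t w, (1 <= t)%N -> 0 <= V t w <= 1.
Hypothesis M01 : forall t w, (1 <= t)%N -> 0 <= M t w <= 1.
Local Notation vs w := (fun s => V s w).
Local Notation ms w := (fun s => M s w).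

Section step.
Variable n : nat.
Hypothesis mV : forall s, (0 < s <= n)%N -> measurable_fun setT (V s).
Hypothesis mM : forall s, (0 < s <= n)%N -> measurable_fun setT (M s).
Hypothesis mB : forall s, (0 < s <= n)%N -> measurable_fun setT (bidRV gamma V M s).

Lemma measurable_win s : (0 < s <= n)%N ->
  measurable_fun setT (fun w => win gamma (vs w) (ms w) s).
Proof. by move=> sn; apply: measurable_fun_ler; [exact: mM|exact: mB]. Qed.

Lemma measurable_nwins :
  measurable_fun setT (fun w => nwins gamma (vs w) (ms w) n).
Proof.
apply: measurable_sum_nat => s sn; apply: measurable_natr_bool.
exact: measurable_win.
Qed.

Lemma measurable_vhat :
  measurable_fun setT (fun w => vhat gamma (vs w) (ms w) n).
Proof.
apply: measurable_funM.
  apply: measurable_sum_nat => s sn; apply: measurable_funM; first exact: mV.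
  by apply: measurable_natr_bool; exact: measurable_win.
apply: measurable_inv_ge0; first by move=> w; exact: nwins_ge0.
exact: measurable_nwins.
Qed.

Lemma measurable_radius :
  measurable_fun setT (fun w => radius gamma (vs w) (ms w) n).
Proof.
apply: (measurableT_comp measurable_sqrt); apply: measurable_funM => //.
apply: measurable_inv_ge0; first by move=> w; rewrite mulr_ge0 ?nwins_ge0.
by apply: measurable_funM => //; exact: measurable_nwins.
Qed.

Lemma measurable_uhat b :
  measurable_fun setT (fun w => uhat gamma (vs w) (ms w) n b).
Proof.
apply: measurable_funM.
  by apply: measurable_funB => //; exact: measurable_vhat.
apply: measurable_funM => //; apply: measurable_sum_nat => s sn.
by apply: measurable_natr_bool; apply: measurable_fun_ltr => //; exact: mM.
Qed.

Lemma measurable_uhat_max : (0 < n)%N ->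
  measurable_fun setT (fun w => uhat_max gamma (vs w) (ms w) n).
Proof.
move=> n0; apply: measurable_gtP => x.
rewrite (_ : [set _ | _] = \bigcup_(q : rat)
    [set w | 0 <= (ratr q : R) <= 1 /\ x < uhat gamma (vs w) (ms w) n (ratr q)]).
  apply: bigcupT_measurable_rat => q.
  have [q01|nq] := boolP (0 <= (ratr q : R) <= 1).
    rewrite (_ : [set _ | _] = [set w | x < uhat gamma (vs w) (ms w) n (ratr q)]).
      by apply: measurable_lt_set => //; exact: measurable_uhat.
    by apply/seteqP; split => w /=; [case|].
  by rewrite (_ : [set _ | _] = set0)//; apply/seteqP; split => w //= [].
apply/seteqP; split => w /=.
  move/(uhat_max_gtP gamma (fun s => @V01 s w) (fun s => @M01 s w) _ n0) => [q qP].
  by exists q.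
case=> q _ qP.
by apply/(uhat_max_gtP gamma (fun s => @V01 s w) (fun s => @M01 s w) _ n0); exists q.
Qed.

Lemma measurable_bid_succ : (0 < n)%N ->
  measurable_fun setT (bidRV gamma V M n.+1).
Proof.
move=> n0; apply: measurable_gtP => x.
have [x0|x0] := leP 0 x; last first.
  rewrite (_ : [set _ | _] = setT)//; apply/seteqP; split => w //= _.
  by have /andP[+ _] := bid_itv gamma (vs w) (ms w) n; exact: lt_le_trans.
rewrite (_ : [set _ | _] = \bigcup_(q : rat)
    [set w | x < ratr q /\ bid_set gamma (vs w) (ms w) n (ratr q)]).
  apply: bigcupT_measurable_rat => q.
  have [/andP[xq q01]|nq] := boolP ((x < ratr q) && (0 <= (ratr q : R) <= 1)).
    rewrite (_ : [set _ | _] =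
      [set w | ratr q <= vhat gamma (vs w) (ms w) n + radius gamma (vs w) (ms w) n]
      `&` [set w | uhat_max gamma (vs w) (ms w) n
             - 2 * radius gamma (vs w) (ms w) n
             <= uhat gamma (vs w) (ms w) n (ratr q)]).
      apply: measurableI; apply: measurable_le_set => //.
      - by apply: measurable_funD; [exact: measurable_vhat|exact: measurable_radius].
      - apply: measurable_funB; first exact: measurable_uhat_max.
        by apply: measurable_funM => //; exact: measurable_radius.
      - exact: measurable_uhat.
    by apply/seteqP; split => w /=; [case=> _ [_ []]|case; split].
  rewrite (_ : [set _ | _] = set0)//; apply/seteqP; split => w //= [xq [q01 _]].
  by move: nq; rewrite xq q01.
apply/seteqP; split => w /=.
  by move/(bid_gtP gamma _ _ n0 x0) => [q qP]; exists q.
by case=> q _ qP; apply/(bid_gtP gamma _ _ n0 x0); exists q.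
Qed.

End step.

(** The sigma-algebra is arbitrary and only rounds up to n are assumed measurable, so that on
    [history] this says that the bid of round n + 1 is a function of the past. *)
Lemma measurable_bid n :
  (forall s, (0 < s <= n)%N -> measurable_fun setT (V s)) ->
  (forall s, (0 < s <= n)%N -> measurable_fun setT (M s)) ->
  forall s, (0 < s <= n.+1)%N -> measurable_fun setT (bidRV gamma V M s).
Proof.
elim: n => [|n IH] mV mM s.
  by case: s => [//|[|//]] _; exact: measurable_cst.
have mB : forall s, (0 < s <= n.+1)%N -> measurable_fun setT (bidRV gamma V M s).
  apply: IH => r /andP[r0 rn]; [apply: mV|apply: mM];
  by rewrite r0 (leq_trans rn).
move=> /andP[s0]; rewrite leq_eqVlt => /predU1P[->|sn]; last by apply: mB; rewrite s0.
exact: measurable_bid_succ.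
Qed.

End process.
End bid_measurability.

(** * Moment generating functions *)

Section moment_generating_functions.
Context {R : realType} d (T : measurableType d) (P : probability T R).
Implicit Types (f g X : T -> R) (t p c : R).

Lemma measurable_fun_expR f :
  measurable_fun setT f -> measurable_fun setT (fun w => expR (f w)).
Proof. by move=> mf; apply/measurableT_comp. Qed.

Lemma integral_prob_cst c : (\int[P]_w c%:E = c%:E)%E.
Proof. by rewrite integral_cst//= probability_setT mule1. Qed.

Lemma le_integral_fin f g : measurable_fun setT f -> measurable_fun setT g ->
  (forall w, 0 <= f w <= g w) -> (\int[P]_w (f w)%:E <= \int[P]_w (g w)%:E)%E.
Proof.
move=> mf mg fg; apply: ge0_le_integral => //.
- by move=> w _; rewrite lee_fin; have /andP[] := fg w.
- exact/measurable_EFinP.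
- exact/measurable_EFinP.
- by move=> w _; rewrite lee_fin; have /andP[] := fg w.
Qed.

Lemma integral_finD f g : measurable_fun setT f -> measurable_fun setT g ->
  (forall w, 0 <= f w) -> (forall w, 0 <= g w) ->
  (\int[P]_w (f w + g w)%:E = \int[P]_w (f w)%:E + \int[P]_w (g w)%:E)%E.
Proof.
move=> mf mg f0 g0; under eq_integral do rewrite EFinD.
rewrite ge0_integralD//.
- by move=> w _; rewrite lee_fin.
- exact/measurable_EFinP.
- by move=> w _; rewrite lee_fin.
- exact/measurable_EFinP.
Qed.

Lemma integral_finZ f c : measurable_fun setT f -> (forall w, 0 <= f w) ->
  0 <= c -> (\int[P]_w (c * f w)%:E = c%:E * \int[P]_w (f w)%:E)%E.
Proof.
move=> mf f0 c0; under eq_integral do rewrite EFinM.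
rewrite ge0_integralZl_EFin//.
  by move=> w _; rewrite lee_fin.
exact/measurable_EFinP.
Qed.

Lemma integral_fin_sum (m n : nat) (h : nat -> T -> R) :
  (forall s, (m <= s < n)%N -> measurable_fun setT (h s)) ->
  (forall s w, (m <= s < n)%N -> 0 <= h s w) ->
  (\int[P]_w (\sum_(m <= s < n) h s w)%:E =
   \sum_(m <= s < n) \int[P]_w (h s w)%:E)%E.
Proof.
move=> mh h0; have [nm|mn] := leqP n m.
  by rewrite !big_geq//; under eq_integral do rewrite big_geq//; rewrite integral0.
elim: n mn mh h0 => // n IH; rewrite ltnS => mn mh h0.
under eq_integral do rewrite big_nat_recr//=.
have sn s : (m <= s < n)%N -> (m <= s < n.+1)%N.
  by move=> /andP[-> /ltnW].
rewrite integral_finD; last 4 first.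
- by apply: measurable_sum_nat => s /sn; exact: mh.
- by apply: mh; rewrite mn leqnn.
- by move=> w; rewrite big_nat sumr_ge0// => s /sn; exact: h0.
- by move=> w; apply: h0; rewrite mn leqnn.
rewrite big_nat_recr//=; congr (_ + _)%E.
move: mn; rewrite leq_eqVlt => /predU1P[<-|mn].
  by rewrite big_geq//; under eq_integral do rewrite big_geq//; rewrite integral0.
by apply: IH => // [s /sn|s w /sn]; [exact: mh|exact: h0].
Qed.

Lemma integral_natr_bool (b : T -> bool) : measurable [set w | b w] ->
  (\int[P]_w ((b w)%:R)%:E = P [set w | b w])%E.
Proof.
move=> mb; rewrite -[in RHS](setIT [set w | b w]) -integral_indic//.
apply: eq_integral => w _; rewrite indicE; congr ((nat_of_bool _)%:R)%:E.
by apply/idP/idP => [bw|]; [rewrite inE|rewrite inE].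
Qed.

(** Convexity from tangents: the tangent of the exponential at t x, evaluated at 0 and at t, is
    averaged with weights 1 - x and x. *)
Lemma expR_convex_le x t : 0 <= x <= 1 ->
  expR (t * x) <= (1 - x) + expR t * x.
Proof.
move=> /andP[x0 x1].
have h0 : expR (t * x) * (1 - t * x) <= 1.
  rewrite -[leRHS]expR0 -(subrr (t * x)) expRD ler_wpM2l ?expR_ge0//.
  by have := expR_ge1Dx (- (t * x)).
have h1 : expR (t * x) * (1 + (t - t * x)) <= expR t.
  rewrite (_ : expR t = expR (t * x) * expR (t - t * x)).
    by rewrite ler_wpM2l ?expR_ge0// expR_ge1Dx.
  by rewrite -expRD; congr expR; ring.
have h2 := ler_wpM2l x0 h1.
have h3 : 0 <= (1 - x) * (1 - expR (t * x) * (1 - t * x)).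
  by rewrite mulr_ge0//; lra.
lra.
Qed.

(** The chord bound replaces X by a Bernoulli variable of the same mean, for which
    [bernoulli_mgf_le] applies. *)
Lemma hoeffding_mgf X p t : measurable_fun setT X ->
  (forall w, 0 <= X w <= 1) -> (\int[P]_w (X w)%:E = p%:E)%E ->
  (\int[P]_w (expR (t * (X w - p)))%:E <= (expR (t ^+ 2 / 8))%:E)%E.
Proof.
move=> mX X01 Xp.
have X0 w : 0 <= X w by have /andP[] := X01 w.
have X1 w : 0 <= 1 - X w by have /andP[] := X01 w; rewrite subr_ge0.
have m1X : measurable_fun setT (fun w => 1 - X w) by exact: measurable_funB.
have p1 : (\int[P]_w (1 - X w)%:E = (1 - p)%:E)%E.
  have := integral_finD m1X mX X1 X0.
  under eq_integral do rewrite subrK.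
  rewrite integral_prob_cst Xp.
  move/eqP; rewrite -sube_eq//; first by move=> /eqP <-; rewrite EFinB.
  by rewrite fin_num_adde_defl.
have p0 : 0 <= p.
  by rewrite -lee_fin -Xp; apply: integral_ge0 => w _; rewrite lee_fin.
have p1' : p <= 1.
  rewrite -subr_ge0 -lee_fin -p1; apply: integral_ge0 => w _; rewrite lee_fin.
  exact: X1.
have mexp : measurable_fun setT (fun w => expR (t * X w)).
  by apply: measurable_fun_expR; exact: measurable_funM.
have E1 : (\int[P]_w (expR (t * X w))%:E <= (1 - p + p * expR t)%:E)%E.
  apply: (@le_trans _ _ (\int[P]_w ((1 - X w) + expR t * X w)%:E)%E).
    apply: le_integral_fin => //.
      by apply: measurable_funD => //; exact: measurable_funM.
    by move=> w; rewrite expR_ge0/= expR_convex_le.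
  rewrite integral_finD//; last 2 first.
  - exact: measurable_funM.
  - by move=> w; rewrite mulr_ge0 ?expR_ge0.
  by rewrite integral_finZ ?expR_ge0// p1 Xp -EFinM -EFinD [expR t * p]mulrC.
rewrite (_ : (\int[P]_w _)%E =
    (\int[P]_w (expR (- (t * p)) * expR (t * X w))%:E)%E); last first.
  by apply: eq_integral => w _; rewrite -expRD; congr (expR _)%:E; ring.
rewrite integral_finZ ?expR_ge0//.
apply: (@le_trans _ _ ((expR (- (t * p)))%:E * (1 - p + p * expR t)%:E)%E).
  by rewrite lee_wpmul2l// lee_fin expR_ge0.
rewrite -EFinM lee_fin.
have := @bernoulli_mgf_le R p t; rewrite p0 p1' => /(_ isT) h.
rewrite (_ : t ^+ 2 / 8 = - (t * p) + (t * p + t ^+ 2 / 8)); last by ring.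
by rewrite expRD ler_wpM2l ?expR_ge0.
Qed.

End moment_generating_functions.

(** * Price distribution and optimal bid *)

Section cdf.
Context {R : realType} d (T : measurableType d) (P : probability T R).
Variables (M : nat -> T -> R) (F : R -> R).
Hypothesis mM : forall t, measurable_fun setT (M t).
Hypothesis M01 : forall t w, (1 <= t)%N -> 0 <= M t w <= 1.
Hypothesis cdfM : forall t b, (1 <= t)%N -> P [set w | M t w <= b] = (F b)%:E.

Lemma cdf_homo x y : x <= y -> F x <= F y.
Proof.
move=> xy; rewrite -lee_fin -!(cdfM _ (leqnn 1)).
apply: le_measure; rewrite ?inE; try exact: measurable_le_set.
by move=> w /= /le_trans; apply.
Qed.

Lemma cdf_ge0 x : 0 <= F x.
Proof. by rewrite -lee_fin -(cdfM _ (leqnn 1)). Qed.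

Lemma cdf_le1 x : F x <= 1.
Proof.
rewrite -lee_fin -(cdfM _ (leqnn 1)).
by apply: probability_le1; exact: measurable_le_set.
Qed.

Lemma cdf_at_right x e : 0 < e -> exists2 y, x < y & F y < F x + e.
Proof.
move=> e0; apply: contrapT => /forall2NP ye.
pose A (j : nat) := [set w | M 1%N w <= x + j.+1%:R^-1].
have AE : \bigcap_j A j = [set w | M 1%N w <= x].
  apply/seteqP; split=> w /=; last first.
    by move=> Mx j _; rewrite /A/= (le_trans Mx)// lerDl.
  move=> Aw; rewrite leNgt; apply/negP => xM.
  have x0 : 0 < M 1%N w - x by rewrite subr_gt0.
  have := Aw (Num.truncn (M 1%N w - x)^-1) I; rewrite /A/=.
  apply/negP; rewrite -ltNge -ltrBrDl.
  rewrite -[ltRHS]invrK ltf_pV2 ?posrE ?invr_gt0//.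
  exact: truncnS_gt.
have mA j : measurable (A j) by exact: measurable_le_set.
have cA : P (A j) @[j --> \oo] --> P (\bigcap_j A j).
  apply: nonincreasing_cvg_mu => //.
  - by apply: (@le_lt_trans _ _ 1%E); [exact: probability_le1|exact: ltry].
  - exact: bigcapT_measurable.
  - move=> i j ij; apply/subsetPset => w /= /le_trans; apply.
    by rewrite lerD2l lef_pV2 ?posrE// ler_nat.
have : ((F x + e)%:E <= P (\bigcap_j A j))%E.
  rewrite -(cvg_lim _ cA)//; apply: lime_ge; first by apply/cvg_ex; exists (P (\bigcap_j A j)).
  apply: nearW => j; rewrite /A cdfM// lee_fin leNgt; apply/negP => Fy.
  by have [] := ye (x + j.+1%:R^-1) => // ; rewrite ltrDl.
by rewrite AE cdfM// lee_fin gerDl leNgt e0.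
Qed.

(** The witness is the p-quantile, the supremum of the x in [0, 1] with F x < p: prices strictly
    below it form an increasing union of events of probability at most p. If there is no such x, 0
    works, since prices are nonnegative. Strict inequality avoids a possible atom at the
    quantile. *)
Lemma prob_lt_le_quantile (p : R) : 0 <= p -> exists g : R,
  (forall s, (1 <= s)%N -> (P [set w | (M s w < g)%R] <= p%:E)%E) /\
  (forall x, 0 <= x <= 1 -> F x < p -> x <= g).
Proof.
move=> p0; pose S := [set x : R | 0 <= x <= 1 /\ F x < p].
have [S0|] := pselect (S !=set0); last first.
  move=> S0; exists 0; split=> [s s1|x x01 Fx]; last by case: S0; exists x.
  rewrite (_ : [set _ | _] = set0) ?measure0 ?lee_fin//.
  apply/seteqP; split=> w //=; apply/negP; rewrite -leNgt.
  by have /andP[] := M01 w s1.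
have Sub : has_ubound S by exists 1 => x [/andP[]].
exists (sup S); split=> [s s1|x x01 Fx]; last exact: ub_le_sup.
pose A (j : nat) := [set w | M s w <= sup S - j.+1%:R^-1].
have AE : \bigcup_j A j = [set w | M s w < sup S].
  apply/seteqP; split=> w /=.
    by move=> [j _ /le_lt_trans]; apply; rewrite ltrBlDr ltrDl.
  move=> Mx; have x0 : 0 < sup S - M s w by rewrite subr_gt0.
  exists (Num.truncn (sup S - M s w)^-1) => //; rewrite /A/= lerBrDr -lerBrDl.
  rewrite -[leRHS]invrK lef_pV2 ?posrE ?invr_gt0//.
  by rewrite ltW// truncnS_gt.
have mA j : measurable (A j) by exact: measurable_le_set.
rewrite -AE.
have cA : P (A j) @[j --> \oo] --> P (\bigcup_j A j).
  apply: nondecreasing_cvg_mu => //; first exact: bigcupT_measurable.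
  move=> i j ij; apply/subsetPset => w /= /le_trans; apply.
  by rewrite lerD2l lerN2 lef_pV2 ?posrE// ler_nat.
rewrite -(cvg_lim _ cA)//; apply: lime_le.
  by apply/cvg_ex; exists (P (\bigcup_j A j)).
apply: nearW => j; rewrite /A cdfM// lee_fin.
have [x [x01 Fx] xj] : exists2 x, S x & sup S - j.+1%:R^-1 < x.
  by apply: sup_gt => //; rewrite ltrBlDr ltrDl.
by rewrite (le_trans _ (ltW Fx))// cdf_homo// ltW.
Qed.

Variable v : R.
Hypothesis v01 : 0 <= v <= 1.

Lemma util_has_sup : has_sup [set util v F b | b in [set b : R | 0 <= b <= 1]].
Proof.
split; first by exists (util v F 0), 0 => //=; rewrite lexx ler01.
exists 1 => _ [b /andP[b0 b1] <-]; rewrite /util.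
by have := cdf_ge0 b; have := cdf_le1 b; move: v01 => /andP[]; nra.
Qed.

Lemma util_le_max b : 0 <= b <= 1 -> util v F b <= util_max v F.
Proof.
by move=> b01; apply: ub_le_sup; [case: util_has_sup|exists b].
Qed.

Lemma util_max_ge0 : 0 <= util_max v F.
Proof. by rewrite (le_trans _ (util_le_max v01))// /util subrr mul0r. Qed.

Lemma util_max_le : util_max v F <= v.
Proof.
apply: ge_sup; first by case: util_has_sup.
move=> _ [b /andP[b0 b1] <-]; rewrite /util.
by have := cdf_ge0 b; have := cdf_le1 b; move: v01 => /andP[]; nra.
Qed.

Lemma regret_le1 b : 0 <= b <= 1 -> util_max v F - util v F b <= 1.
Proof.
move=> /andP[b0 b1]; have := util_max_le.
have := cdf_ge0 b; have := cdf_le1 b; rewrite /util.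
by move: v01 => /andP[]; nra.
Qed.

Lemma util_max_attained : 0 < util_max v F ->
  exists2 b, 0 <= b < v & util v F b = util_max v F.
Proof.
move=> U0; set U := util_max v F in U0 *.
have lt_v x : 0 < util v F x -> x < v.
  by rewrite /util; have := cdf_ge0 x; case: ltP => //; nra.
pose S := [set b : R | 0 <= b <= 1 /\ forall e, 0 < e ->
  exists2 x, b <= x <= 1 & U - e < util v F x].
have near_max e : 0 < e -> exists2 x, 0 <= x <= 1 & U - e < util v F x.
  move=> e0; have [|_ [x x01 <-] xe] := @sup_gt _ _ (U - e) (proj1 util_has_sup).
    by rewrite ltrBlDr ltrDl.
  by exists x.
have S0 : S 0 by split=> //; rewrite lexx ler01.
have Sub : has_ubound S by exists 1 => x [/andP[]].
have s0 : 0 <= sup S by exact: ub_le_sup.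
have s1 : sup S <= 1 by apply: ge_sup; [exists 0|move=> x [/andP[]]].
have sv : sup S <= v.
  apply: ge_sup; first by exists 0.
  move=> b [_ bS]; have [x /andP[bx _]] := bS U U0.
  by rewrite subrr => /lt_v /ltW; exact: le_trans.
suff Us : U <= util v F (sup S).
  exists (sup S); first by rewrite s0 lt_v// (lt_le_trans U0).
  by apply/eqP; rewrite eq_le Us util_le_max// s0.
rewrite leNgt; apply/negP => sU; set s := sup S in s0 s1 sv sU *.
(* Of the gap 4 e, at most e is lost through the factor v - x and at most e through the increase of
   F, which leaves 2 e. *)
pose e := (U - util v F s) / 4.
have e0 : 0 < e by rewrite /e; lra.
have [y sy Fy] := cdf_at_right s e0.
pose z := Num.min y (s + e).
have sz : s < z by rewrite lt_min sy ltrDl.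
have small x : s - e < x -> x < z -> 0 <= x -> util v F x <= U - 2 * e.
  move=> ex xz x0; have xy : x <= y by rewrite ltW// (lt_le_trans xz)// ge_min lexx.
  have Fx : F x <= F s + e by rewrite (le_trans (cdf_homo xy))// ltW.
  rewrite /util; have := cdf_ge0 x; have := cdf_ge0 s; have := cdf_le1 s.
  have := cdf_le1 x.
  have : U = util v F s + 4 * e by rewrite /e; field.
  rewrite /util => -> Fx1 Fs1 Fs0 Fx0.
  have h1 : (v - x) * F x <= (v - s + e) * F x by rewrite ler_wpM2r//; lra.
  have h2 : (v - s + e) * F x <= (v - s) * F x + e.
    by rewrite mulrDl lerD2l ler_piMr// ltW.
  have h3 : (v - s) * F x <= (v - s) * (F s + e) by rewrite ler_wpM2l// subr_ge0.
  have h4 : (v - s) * e <= e.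
    by rewrite ler_piMl// ?(ltW e0)//; move: v01 => /andP[]; lra.
  by lra.
have [b [b01 bS] bs] : exists2 b, S b & s - e < b.
  by apply: sup_gt; [exists 0|rewrite ltrBlDr ltrDl].
have zS x : b <= x <= 1 -> U - 2 * e < util v F x -> z <= x.
  move=> /andP[bx x1] Ux; rewrite leNgt; apply/negP => xz.
  have := small x (lt_le_trans bs bx) xz; rewrite (le_trans _ bx).
    by move=> /(_ isT); rewrite leNgt Ux.
  by move: b01 => /andP[].
have z1 : z <= 1.
  have e20 : 0 < 2 * e by lra.
  by have [x /andP[bx x1] /zS] := bS _ e20; rewrite bx x1 => /(_ isT)/le_trans; apply.
have : S z.
  split; first by rewrite z1 (le_trans s0)// ltW.
  move=> r r0; have m0 : 0 < Num.min r (2 * e) by rewrite lt_min r0; lra.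
  have [x bx Ux] := bS _ m0; exists x.
    have /andP[_ ->] := bx; rewrite andbT; apply: zS => //.
    by apply: le_lt_trans Ux; rewrite lerD2l lerN2 ge_min lexx orbT.
  by apply: le_lt_trans Ux; rewrite lerD2l lerN2 ge_min lexx.
by move=> /(ub_le_sup Sub); rewrite leNgt sz.
Qed.

(** Maximisers x approach [bstar v F] from below. F can only grow from x to the limit, so the
    utility drops by at most the distance, which tends to 0. *)
Lemma bstar_argmax : 0 < util_max v F ->
  0 <= bstar v F < v /\ util v F (bstar v F) = util_max v F.
Proof.
move=> U0; have [b /andP[b0 bv] Ub] := util_max_attained U0.
move: v01 => /andP[v0 v1].
pose S := [set b : R | 0 <= b <= 1 /\ util v F b = util_max v F].
have Sb : S b by split=> //; rewrite b0; lra.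
have Sub : has_ubound S by exists 1 => x [/andP[]].
have lt_v x : S x -> x < v.
  move=> [_ Ux]; move: U0; rewrite -Ux /util; have := cdf_ge0 x.
  by case: ltP => //; nra.
have s0 : 0 <= bstar v F by rewrite (le_trans b0)//; exact: ub_le_sup.
have sv : bstar v F <= v.
  by apply: ge_sup => [|x /lt_v /ltW//]; exists b.
suff Us : util_max v F <= util v F (bstar v F).
  have UE : util v F (bstar v F) = util_max v F.
    by apply/eqP; rewrite eq_le Us util_le_max// s0; lra.
  split=> //; rewrite s0/=; apply: lt_v; split=> //.
  by rewrite s0; lra.
rewrite leNgt; apply/negP => sU.
have [x Sx xs] : exists2 x, S x & bstar v F - (util_max v F - util v F (bstar v F)) < x.
  by apply: sup_gt; [exists b|rewrite ltrBlDr ltrDl subr_gt0].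
have xb : x <= bstar v F by exact: ub_le_sup.
have Fx := cdf_homo xb; have xv := lt_v _ Sx.
case: Sx => _ Ux.
have h1 : (v - x) * F x <= (v - x) * F (bstar v F) by rewrite ler_wpM2l//; lra.
have h2 : (bstar v F - x) * F (bstar v F) <= bstar v F - x.
  by rewrite ler_piMr ?cdf_le1//; lra.
move: Ux xs sU; rewrite /util; lra.
Qed.

End cdf.

(** * Deviation exponents *)

Section deviation_estimates.
Context {R : realType}.
Implicit Types (g n : R).

(** With [r = sqrt N] in [[b^j, b^(j+1))] and [y = r / b^j], the choice
    [t = 4 c / b^j] yields the exponent [2 c^2 (1 - (y - 1)^2)]. *)
Lemma peeling_exponent (c r b x S : R) : 0 <= c -> 0 < x -> x <= r < b * x ->
  c * r <= S ->
  2 * c ^+ 2 * (1 - (b - 1) ^+ 2) <=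
    4 * c / x * S - (4 * c / x) ^+ 2 / 8 * r ^+ 2.
Proof.
move=> c0 x0 /andP[xr rb] cS.
have t0 : 0 <= 4 * c / x by rewrite divr_ge0 ?mulr_ge0// ltW.
apply: (@le_trans _ _ (4 * c / x * (c * r) - (4 * c / x) ^+ 2 / 8 * r ^+ 2)); last first.
  by rewrite lerD2r ler_wpM2l.
pose y := r / x.
have y1 : 1 <= y by rewrite ler_pdivlMr// mul1r.
have yb : y <= b by rewrite ler_pdivrMr// ltW.
have -> : 4 * c / x * (c * r) - (4 * c / x) ^+ 2 / 8 * r ^+ 2
    = 2 * c ^+ 2 * (1 - (y - 1) ^+ 2).
  by rewrite /y; field; rewrite gt_eqF.
rewrite ler_wpM2l ?mulr_ge0 ?sqr_ge0// lerD2l lerN2.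
by rewrite lerXn2r ?nnegrE; lra.
Qed.

(** The two mass points satisfy [p a <= q c], which bounds the variance by
    [q (1 - q)] up to a multiple of the (nonpositive) mean; the maximum over [q]
    of [24 q - 18 q^2] is [8]. *)
Lemma price_mgf_bound (a c e p q : R) : 0 <= a -> 0 < c -> a + c <= 1 ->
  0 <= p -> 0 <= q -> p + q <= 1 -> p * a <= q * c -> 0 <= e -> e <= 1 / 20 ->
  expR (6 * e * a) * p + expR (6 * e * (e - c)) * q + (1 - p - q)
    <= expR (8 * e ^+ 2 + 234 * e ^+ 3).
Proof.
move=> a0 c0 ac p0 q0 pq pa e0 e1.
(* For t = k e and the worst q, the exponent at threshold 2 e is e^2 ((1 + k/2)^2 / 2 - 2 k) up to
   order e^3; k = 6 minimises it, with value - 4 e^2. *)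
set t := 6 * e.
have t0 : 0 <= t by rewrite /t; lra.
have t1 : t <= 1 by rewrite /t; lra.
have cube (x : R) : - 1 <= x <= 1 ->
    expR (t * x) <= 1 + t * x + t ^+ 2 / 2 * x ^+ 2 + t ^+ 3.
  move=> /andP[x0 x1].
  have nx : `|x| <= 1 by rewrite ler_norml x0.
  have tx : `|t * x| <= t by rewrite normrM ger0_norm// ler_piMr.
  apply: (le_trans (expR_le_cubic (le_trans tx t1))).
  have -> : t ^+ 2 / 2 * x ^+ 2 = (t * x) ^+ 2 / 2 by ring.
  by rewrite lerD2l lerXn2r ?nnegrE.
have h1 : expR (t * a) * p <= (1 + t * a + t ^+ 2 / 2 * a ^+ 2 + t ^+ 3) * p.
  by rewrite ler_wpM2r// cube//; lra.
have h2 : expR (t * (e - c)) * q <=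
    (1 + t * (e - c) + t ^+ 2 / 2 * (e - c) ^+ 2 + t ^+ 3) * q.
  by rewrite ler_wpM2r// cube//; lra.
have t3 : t ^+ 3 * (p + q) <= t ^+ 3 by rewrite ler_piMr// exprn_ge0.
pose m := q * c - p * a.
have m0 : 0 <= m by rewrite subr_ge0.
have var : p * a ^+ 2 + q * c ^+ 2 <= q * (1 - q) + q * m.
  have pa1 : p * a <= (1 - q) * (1 - c).
    apply: (@le_trans _ _ ((1 - q) * a)); first by rewrite ler_wpM2r//; lra.
    by rewrite ler_wpM2l//; lra.
  have cq : c <= 1 - q + m by rewrite /m; lra.
  have s1 : p * a * a <= q * c * a by rewrite ler_wpM2r.
  have s2 : q * c * (a + c) <= q * c * 1 by rewrite ler_wpM2l// mulr_ge0// ltW.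
  have s3 : q * c <= q * (1 - q + m) by rewrite ler_wpM2l.
  have -> : p * a ^+ 2 + q * c ^+ 2 = p * a * a + q * c * c by ring.
  by lra.
have ec : (e - c) ^+ 2 * q <= c ^+ 2 * q + e ^+ 2.
  have : e ^+ 2 * q <= e ^+ 2 by rewrite ler_piMr ?sqr_ge0//; lra.
  have : 0 <= e * c * q by rewrite !mulr_ge0// ltW.
  by lra.
have t2 : 0 <= t ^+ 2 / 2 by rewrite divr_ge0 ?sqr_ge0.
have v1 : t ^+ 2 / 2 * (p * a ^+ 2 + (e - c) ^+ 2 * q) <=
    t ^+ 2 / 2 * (q * (1 - q) + q * m + e ^+ 2).
  by rewrite ler_wpM2l//; lra.
(* The linear term contributes - t m, which absorbs the excess of the variance over q (1 - q). *)
have qm : t ^+ 2 / 2 * (q * m) <= t * m.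
  have : t * t * (q * m) <= t * 1 * (1 * m).
    rewrite ler_pM ?mulr_ge0//.
      by rewrite ler_wpM2l.
    by rewrite ler_wpM2r//; lra.
  have : 0 <= t * m by rewrite mulr_ge0.
  by lra.
have main : expR (t * a) * p + expR (t * (e - c)) * q + (1 - p - q) <=
    1 + (t * e * q + t ^+ 2 / 2 * (q * (1 - q)) + t ^+ 2 / 2 * e ^+ 2 + t ^+ 3).
  have mE : t * m = t * (q * c) - t * (p * a) by rewrite /m; ring.
  by lra.
apply: (le_trans main); apply: (le_trans (expR_ge1Dx _)); rewrite ler_expR.
have q2 : 0 <= e ^+ 2 * (3 * q - 2) ^+ 2 by rewrite mulr_ge0 ?sqr_ge0.
have e4 : e ^+ 4 <= e ^+ 3 by rewrite exprS ler_piMl ?exprn_ge0//; lra.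
have -> : t * e * q + t ^+ 2 / 2 * (q * (1 - q)) + t ^+ 2 / 2 * e ^+ 2 + t ^+ 3
  = 8 * e ^+ 2 - 2 * (e ^+ 2 * (3 * q - 2) ^+ 2) + 18 * e ^+ 4 + 216 * e ^+ 3.
  by rewrite /t; field.
lra.
Qed.

(** [n e^3] stays bounded because [ln n ^ 3 <= 6 n]. *)
Lemma conf_radius_cube g (n : nat) : 0 <= g -> (0 < n)%N ->
  n%:R * Num.sqrt (g * ln n%:R / (2 * n%:R)) ^+ 3 <= g ^+ 3 + 1.
Proof.
move=> g0 n0; set e := Num.sqrt _; have nR : (0 : R) < n%:R by rewrite ltr0n.
have L0 := @ln_nat_ge0 R n; have L3 := @ln_nat_cube R n.
have e0 : 0 <= e by exact: sqrtr_ge0.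
have e2 : e ^+ 2 = g * ln n%:R / (2 * n%:R).
  by rewrite sqr_sqrtr// divr_ge0 ?mulr_ge0.
have sq : (n%:R * e ^+ 3) ^+ 2 <= g ^+ 3.
  have -> : (n%:R * e ^+ 3) ^+ 2 = n%:R ^+ 2 * (e ^+ 2) ^+ 3 by ring.
  rewrite e2.
  have -> : n%:R ^+ 2 * (g * ln n%:R / (2 * n%:R)) ^+ 3
      = g ^+ 3 * (ln n%:R ^+ 3 / (8 * n%:R)) by field; rewrite gt_eqF.
  rewrite ler_piMr ?exprn_ge0// ler_pdivrMr ?mulr_gt0//; lra.
have x0 : 0 <= n%:R * e ^+ 3 by rewrite mulr_ge0 ?exprn_ge0.
have g3 : 0 <= g ^+ 3 by rewrite exprn_ge0.
by move: sq x0 g3; nra.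
Qed.

End deviation_estimates.

(** * Concentration along the auction *)

Definition rounds_upto (n : nat) : set (nat + nat) :=
  [set i | (1 <= round_index i <= n)%N].

(** What is known just before the value of round n + 1 is revealed: its price is included, because
    it decides whether the round is won. *)
Definition rounds_upto_price (n : nat) : set (nat + nat) :=
  [set i | (1 <= round_index i <= n)%N \/ i = inr n.+1].

Section auction.
Context {R : realType} d (Omega : measurableType d) (P : probability Omega R).
Variables (V M : nat -> Omega -> R) (v : R) (F : R -> R) (gamma : R).
Hypothesis mV : forall t, measurable_fun setT (V t).
Hypothesis mM : forall t, measurable_fun setT (M t).
Hypothesis V01 : forall t w, (1 <= t)%N -> 0 <= V t w <= 1.
Hypothesis M01 : forall t w, (1 <= t)%N -> 0 <= M t w <= 1.
Hypothesis idV : forall t, (1 <= t)%N -> forall A : set R, measurable A ->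
  P (V t @^-1` A) = P (V 1%N @^-1` A).
Hypothesis meanV : ('E_P[V 1%N] = v%:E)%E.
Hypothesis cdfM : forall t b, (1 <= t)%N -> P [set w | M t w <= b] = (F b)%:E.
Hypothesis indVM :
  mutually_independent P [set i | (1 <= round_index i)%N] (VM V M).

Local Notation vs w := (fun s => V s w).
Local Notation ms w := (fun s => M s w).
Local Notation hist := (history (VM V M)).

Lemma mVM i : measurable_fun setT (VM V M i).
Proof. by case: i. Qed.

Lemma integral_history j (D : set (nat + nat)) (f : hist D * R -> R) :
  D `<=` [set i | (1 <= round_index i)%N] -> (1 <= round_index j)%N -> ~ D j ->
  measurable_fun setT f -> (forall z, 0 <= f z) ->
  (\int[P]_w (f (w, VM V M j w))%:E
    = \int[P]_w \int[P]_u (f (w, VM V M j u))%:E)%E.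
Proof.
move=> DD j1 Dj mf f0.
apply: (history_integral mVM (f := EFin \o f) indVM DD j1 Dj).
  exact/measurable_EFinP.
by move=> z; rewrite lee_fin.
Qed.

Lemma measurable_history_V D s : D (inl s) ->
  measurable_fun setT (V s : hist D -> R).
Proof. exact: (@measurable_history _ _ _ _ (VM V M) D (inl s)). Qed.

Lemma measurable_history_M D s : D (inr s) ->
  measurable_fun setT (M s : hist D -> R).
Proof. exact: (@measurable_history _ _ _ _ (VM V M) D (inr s)). Qed.

Lemma measurable_history_sub D (f : hist D -> R) :
  measurable_fun setT f -> measurable_fun setT (f : Omega -> R).
Proof.
move=> mf.
exact: (measurableT_comp (g := id : Omega -> hist D) mf
  (measurable_id_history mVM (D := D))).
Qed.

Lemma measurable_history_bid n D s : rounds_upto n `<=` D -> (0 < s <= n.+1)%N ->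
  measurable_fun setT (bidRV gamma V M s : hist D -> R).
Proof.
move=> nD; apply: measurable_bid => //.
- by move=> r rn; apply: measurable_history_V; apply: nD.
- by move=> r rn; apply: measurable_history_M; apply: nD.
Qed.

Lemma mean_V t : (1 <= t)%N -> (\int[P]_w (V t w)%:E = v%:E)%E.
Proof.
move=> t1; rewrite -meanV unlock.
pose Vm s : {mfun Omega >-> R} := HB.pack (V s) (isMeasurableFun.Build _ _ _ _ (V s) (mV s)).
(* Clipping at 0 leaves the values of [V] unchanged and makes the integrand nonnegative on all of R,
   as the transfer to the law requires. *)
pose f (x : R) := (Num.max 0 x)%:E.
have mf : measurable_fun setT f.
  by apply/measurable_EFinP; apply: measurable_maxr.
have tr s : (1 <= s)%N ->
    (\int[P]_w (V s w)%:E = \int[distribution P (Vm s)]_x f x)%E.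
  move=> s1; rewrite ge0_integral_pushforward//; last first.
    by move=> x _; rewrite lee_fin le_max lexx.
  apply: eq_integral => w _; rewrite /f/=; congr (_%:E).
  by rewrite max_r//; have /andP[] := V01 w s1.
rewrite tr// tr//; apply: eq_measure_integral => A mA _; exact: idV.
Qed.

Lemma V_mgf t x : (1 <= t)%N ->
  (\int[P]_w (expR (x * (V t w - v)))%:E <= (expR (x ^+ 2 / 8))%:E)%E.
Proof.
by move=> t1; apply: hoeffding_mgf => // [w|]; [exact: V01|exact: mean_V].
Qed.

(** Each induction step freezes the first n rounds and integrates the last price alone. *)
Lemma expR_sum_price_le (h : R -> R) (t c : R) n : measurable_fun setT h -> 0 <= c ->
  (forall s, (1 <= s)%N -> (\int[P]_w (expR (t * h (M s w)))%:E <= c%:E)%E) ->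
  (\int[P]_w (expR (t * \sum_(1 <= s < n.+1) h (M s w)))%:E <= (c ^+ n)%:E)%E.
Proof.
move=> mh c0 hc; elim: n => [|n IH].
  under eq_integral do rewrite big_geq// mulr0 expR0.
  by rewrite integral_prob_cst expr0.
pose D := rounds_upto n.
pose W w := expR (t * \sum_(1 <= s < n.+1) h (M s w)).
have mW : measurable_fun setT (W : hist D -> R).
  apply: measurable_fun_expR; apply: measurable_funM => //.
  apply: measurable_sum_nat => s sn; apply/measurableT_comp => //.
  exact: measurable_history_M.
have mW' : measurable_fun setT (W : Omega -> R) by exact: (measurable_history_sub mW).
pose f (z : hist D * R) := W z.1 * expR (t * h z.2).
rewrite (_ : (\int[P]_w _)%E =
    (\int[P]_w (f (w, VM V M (inr n.+1) w))%:E)%E); last first.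
  apply: eq_integral => w _; rewrite /f /W -expRD/=; congr (expR _)%:E.
  by rewrite big_nat_recr//= mulrDr.
rewrite (@integral_history (inr n.+1))//; last 4 first.
- by move=> i /andP[].
- by rewrite /D /rounds_upto/= ltnn.
- apply: measurable_funM; first exact: (measurableT_comp (g := fst) mW measurable_fst).
  apply: measurable_fun_expR; apply: measurable_funM => //.
  exact: (measurableT_comp (g := snd) mh measurable_snd).
- by move=> z; rewrite mulr_ge0 ?expR_ge0.
have mth s : measurable_fun setT (fun w => expR (t * h (M s w))).
  apply: measurable_fun_expR; apply: measurable_funM => //.
  by apply/measurableT_comp.
apply: (@le_trans _ _ (\int[P]_w (c * W w)%:E)%E); last first.
  rewrite integral_finZ ?expR_ge0//; last by move=> w; rewrite /W expR_ge0.
  by rewrite exprS EFinM lee_wpmul2l// lee_fin.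
apply: ge0_le_integral => //=.
- by move=> w _; apply: integral_ge0 => u _; rewrite lee_fin mulr_ge0 ?expR_ge0.
- under eq_fun do rewrite /f/= integral_finZ ?expR_ge0//.
  apply: emeasurable_funM => //; exact/measurable_EFinP.
- by apply/measurable_EFinP; exact: measurable_funM.
move=> w _; rewrite /f/= integral_finZ ?expR_ge0//.
by rewrite mulrC EFinM lee_wpmul2l// ?lee_fin ?expR_ge0// hc.
Qed.

Definition win_deviation (w : Omega) n : R :=
  \sum_(1 <= s < n.+1) (V s w - v) * (win gamma (vs w) (ms w) s)%:R.

Lemma measurable_bidRV s : (1 <= s)%N -> measurable_fun setT (bidRV gamma V M s).
Proof.
case: s => // s _; apply: (@measurable_bid _ _ _ gamma V M V01 M01 s) => //.
by rewrite ltnSn.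
Qed.

(** Under the conditioning [rounds_upto_price n], a lost round leaves the exponential unchanged and
    a won one multiplies it by [g (V n.+1)], whose mean is at most 1. The sign of [t] is free, which
    serves both tails. *)
Lemma supermartingale_le1 n (t : R) :
  (\int[P]_w (expR (t * win_deviation w n
     - t ^+ 2 / 8 * nwins gamma (vs w) (ms w) n))%:E <= 1)%E.
Proof.
elim: n => [|n IH].
  under eq_integral do
    rewrite /win_deviation /nwins !big_geq// !mulr0 subr0 expR0.
  by rewrite integral_prob_cst.
pose D := rounds_upto_price n.
pose W w := expR (t * win_deviation w n
  - t ^+ 2 / 8 * nwins gamma (vs w) (ms w) n).
pose b (w : hist D) := win gamma (vs w) (ms w) n.+1.
have nD : rounds_upto n `<=` D by move=> i; left.
have mVD s : (0 < s <= n)%N -> measurable_fun setT (V s : hist D -> R).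
  by move=> sn; apply: measurable_history_V; apply: nD.
have mMD s : (0 < s <= n.+1)%N -> measurable_fun setT (M s : hist D -> R).
  move=> /andP[s0]; rewrite leq_eqVlt => /predU1P[->|sn].
    by apply: measurable_history_M; right.
  by apply: measurable_history_M; apply: nD; rewrite /rounds_upto/= s0.
have mBD s : (0 < s <= n.+1)%N ->
    measurable_fun setT (bidRV gamma V M s : hist D -> R).
  by move=> sn; apply: measurable_history_bid sn.
have mwin s : (0 < s <= n.+1)%N ->
    measurable_fun setT (fun w : hist D => win gamma (vs w) (ms w) s).
  by move=> sn; apply: measurable_fun_ler; [exact: mMD|exact: mBD].
have sn s : (0 < s < n.+1)%N -> (0 < s <= n.+1)%N.
  by move=> /andP[-> /ltnW].
have mb : measurable_fun setT b by apply: mwin; rewrite ltnSn.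
have mW : measurable_fun setT (W : hist D -> R).
  apply: measurable_fun_expR; apply: measurable_funB.
    apply: measurable_funM => //; apply: measurable_sum_nat => s s1.
    apply: measurable_funM; first by apply: measurable_funB => //; exact: mVD.
    by apply: measurable_natr_bool; apply: mwin; apply: sn; exact: s1.
  apply: measurable_funM => //; apply: measurable_sum_nat => s s1.
  by apply: measurable_natr_bool; apply: mwin; apply: sn; exact: s1.
have mW' : measurable_fun setT (W : Omega -> R) by exact: (measurable_history_sub mW).
have W0 w : 0 <= W w by exact: expR_ge0.
pose g (y : R) := expR (- (t ^+ 2 / 8)) * expR (t * (y - v)).
have g0 y : 0 <= g y by rewrite mulr_ge0 ?expR_ge0.
have mg : measurable_fun setT g.
  apply: measurable_funM => //; apply: measurable_fun_expR.
  by apply: measurable_funM => //; exact: measurable_funB.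
pose f (z : hist D * R) := W z.1 * (if b z.1 then g z.2 else 1).
rewrite (_ : (\int[P]_w _)%E =
    (\int[P]_w (f (w, VM V M (inl n.+1) w))%:E)%E); last first.
  apply: eq_integral => w _; rewrite /f /W /b/=; congr (_%:E).
  rewrite nwinsS /win_deviation big_nat_recr//=.
  case: (win gamma (vs w) (ms w) n.+1); last by rewrite mulr0 !addr0 mulr1.
  rewrite /g -!expRD/=; congr expR; ring.
rewrite (@integral_history (inl n.+1))//; last 4 first.
- by move=> i [/andP[]//|->].
- by case; rewrite /= ?ltnn.
- apply: measurable_funM; first exact: (measurableT_comp (g := fst) mW measurable_fst).
  apply: measurable_fun_ifT => //.
  + exact: (measurableT_comp (g := fst) mb measurable_fst).
  + exact: (measurableT_comp (g := snd) mg measurable_snd).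
- by move=> z; rewrite mulr_ge0//; case: ifP.
have fE w : (\int[P]_u (f (w, VM V M (inl n.+1) u))%:E =
    (W w)%:E * (if b w then \int[P]_u (g (V n.+1 u))%:E else 1))%E.
  rewrite /f/= integral_finZ//; last 2 first.
  - by case: (b w); [apply/measurableT_comp|exact: measurable_cst].
  - by move=> u; case: (b w).
  by congr (_ * _)%E; case: (b w) => //; rewrite integral_prob_cst.
have gle1 : (\int[P]_u (g (V n.+1 u))%:E <= 1)%E.
  rewrite /g integral_finZ ?expR_ge0//; last first.
    apply: measurable_fun_expR; apply: measurable_funM => //.
    exact: measurable_funB.
  apply: (@le_trans _ _ ((expR (- (t ^+ 2 / 8)))%:E * (expR (t ^+ 2 / 8))%:E)%E).
    by rewrite lee_wpmul2l ?lee_fin ?expR_ge0// V_mgf.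
  by rewrite -EFinM -expRD addNr expR0.
apply: le_trans IH; rewrite -/W; apply: ge0_le_integral => //.
- move=> w _; apply: integral_ge0 => u _; rewrite lee_fin /f mulr_ge0//.
  by case: ifP.
- under eq_fun do rewrite fE; apply: emeasurable_funM; first exact/measurable_EFinP.
  apply: measurable_fun_ifT => //; by apply: measurable_fun_ler => //; exact: measurable_bidRV.
- exact/measurable_EFinP.
move=> w _; rewrite fE -[leRHS]mule1 lee_wpmul2l ?lee_fin//.
by case: (b w).
Qed.

Lemma expected_radius_win n : (0 < n)%N ->
  (\int[P]_w (radius gamma (vs w) (ms w) n * F (bidRV gamma V M n.+1 w))%:E =
   \int[P]_w (radius gamma (vs w) (ms w) n
     * (win gamma (vs w) (ms w) n.+1)%:R)%:E)%E.
Proof.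
move=> n0; pose D := rounds_upto n.
have mMD s : (0 < s <= n)%N -> measurable_fun setT (M s : hist D -> R).
  by move=> sn; apply: measurable_history_M.
have mBD s : (0 < s <= n.+1)%N ->
    measurable_fun setT (bidRV gamma V M s : hist D -> R).
  by move=> sn; apply: (measurable_history_bid (n := n)).
pose W w := radius gamma (vs w) (ms w) n.
have mW : measurable_fun setT (W : hist D -> R).
  apply: measurable_radius => // s /andP[s0 sn]; apply: mBD.
  by rewrite s0 ltnW.
pose f (z : hist D * R) := W z.1 * ((z.2 <= bidRV gamma V M n.+1 z.1)%R)%:R.
rewrite [RHS](_ : _ = \int[P]_w (f (w, VM V M (inr n.+1) w))%:E)%E//.
rewrite (@integral_history (inr n.+1))//; last 4 first.
- by move=> i /andP[].
- by rewrite /D /rounds_upto/= ltnn.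
- apply: measurable_funM; first exact: (measurableT_comp (g := fst) mW measurable_fst).
  apply: measurable_natr_bool; apply: measurable_fun_ler => //.
  apply: (measurableT_comp (g := fst) (mBD n.+1 _) measurable_fst).
  by rewrite ltnSn.
- by move=> z; rewrite mulr_ge0 ?sqrtr_ge0.
apply: eq_integral => w _; rewrite /f/= integral_finZ ?sqrtr_ge0//; last first.
  apply: measurable_natr_bool; exact: measurable_fun_ler.
rewrite EFinM; congr (_ * _)%E.
rewrite -(cdfM _ (ltn0Sn n)) (integral_natr_bool P)//.
exact: measurable_le_set.
Qed.

(** * Tail estimates for sums over the prices *)

Lemma prob_fin (A : set Omega) : measurable A -> P A = (fine (P A))%:E.
Proof. by move=> mA; rewrite fineK// fin_num_measure. Qed.

Lemma measurable_price_lt s (b : R) : measurable [set w | M s w < b].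
Proof. exact: measurable_lt_set. Qed.

Lemma measurable_price_le s (b : R) : measurable [set w | M s w <= b].
Proof. exact: measurable_le_set. Qed.

Lemma measurable_price_gt s (b : R) : measurable [set w | b < M s w].
Proof. exact: measurable_lt_set. Qed.

Lemma measurable_price_ge s (b : R) : measurable [set w | b <= M s w].
Proof. exact: measurable_le_set. Qed.

Lemma prob_price_ge_le s (g b : R) : (1 <= s)%N -> g <= b ->
  P [set w | (g <= M s w) && (M s w <= b)] =
  (F b - fine (P [set w | M s w < g]))%:E.
Proof.
move=> s1 gb.
have mI : measurable [set w | (g <= M s w) && (M s w <= b)].
  rewrite (_ : [set w | _] = [set w | g <= M s w] `&` [set w | M s w <= b]).
    by apply: measurableI; [exact: measurable_price_ge|exact: measurable_price_le].
  by apply/seteqP; split=> w /= => [/andP[]|[-> ->]].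
have : P [set w | M s w <= b] = (P [set w | ((g <= M s w) && (M s w <= b))%R] +
    P [set w | (M s w < g)%R])%E.
  rewrite -measureU//; last 2 first.
  - exact: measurable_price_lt.
  - apply/seteqP; split=> // w [/= /andP[gM _]]; by rewrite ltNge gM.
  congr (P _); apply/seteqP; split=> w /=.
    by move=> Mb; have [gM|Mg] := leP g (M s w); [left|right].
  by case=> [/andP[]//|/ltW/le_trans]; apply.
rewrite cdfM// (prob_fin mI) (prob_fin (measurable_price_lt s g)) -EFinD.
by case=> ->; rewrite addrK.
Qed.

Lemma prob_price_gt_lt_le s (g b q : R) : (1 <= s)%N ->
  (P [set w | (M s w < g)%R] <= q%:E)%E ->
  (P [set w | ((b < M s w) && (M s w < g))%R] <= (Num.max 0 (q - F b))%:E)%E.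
Proof.
move=> s1 Pq.
have mI : measurable [set w | (b < M s w) && (M s w < g)].
  rewrite (_ : [set w | _] = [set w | b < M s w] `&` [set w | M s w < g]).
    by apply: measurableI; [exact: measurable_price_gt|exact: measurable_price_lt].
  by apply/seteqP; split=> w /= => [/andP[]|[-> ->]].
have [gb|bg] := leP g b.
  rewrite (_ : [set w | _] = set0); first by rewrite measure0 lee_fin le_max lexx.
  apply/seteqP; split=> // w /= /andP[bM /(lt_trans bM)].
  by rewrite ltNge gb.
have : P [set w | M s w < g] = (P [set w | ((b < M s w) && (M s w < g))%R] +
    P [set w | (M s w <= b)%R])%E.
  rewrite -measureU//; last 2 first.
  - exact: measurable_price_le.
  - apply/seteqP; split=> // w [/= /andP[gM _]]; by rewrite leNgt gM.
  congr (P _); apply/seteqP; split=> w /=.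
    by move=> Mb; have [gM|Mg] := leP (M s w) b; [right|left].
  by case=> [/andP[]//|/le_lt_trans]; apply.
move=> PE; rewrite PE cdfM// (prob_fin mI) -EFinD lee_fin in Pq.
by rewrite (prob_fin mI) lee_fin le_max; apply/orP; right; lra.
Qed.

(** Hoeffding's bound at deviation 3/2 e, whose optimal tilt is 4 times that, 6 e. The exponent 9/2
    n e^2 becomes 9/4 gamma ln n, beyond the 2 ln n that a union over n points demands. *)
Lemma expected_price_event_le (A : R -> bool) (p e : R) n :
  measurable_fun setT A -> 0 <= e ->
  (forall s, (1 <= s)%N -> (P [set w | A (M s w)] <= p%:E)%E) ->
  (\int[P]_w (expR (6 * e * (\sum_(1 <= s < n.+1) (A (M s w))%:R
      - n%:R * (p + 3 / 2 * e))))%:E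
    <= (expR (- (9 / 2 * (n%:R * e ^+ 2))))%:E)%E.
Proof.
move=> mA e0 Ap; set t := 6 * e.
have t0 : 0 <= t by rewrite /t; lra.
pose h (y : R) : R := (A y)%:R - p.
have mA' : measurable_fun setT (fun y : R => (A y)%:R : R).
  exact: measurable_natr_bool.
have mh : measurable_fun setT h by exact: measurable_funB.
have mAM s : measurable [set w | A (M s w)].
  have := measurableT_comp mA (mM s) measurableT (Y := [set true]).
  by rewrite setTI; apply.
have step s : (1 <= s)%N ->
    (\int[P]_w (expR (t * h (M s w)))%:E <= (expR (t ^+ 2 / 8))%:E)%E.
  move=> s1; pose ps := fine (P [set w | A (M s w)]).
  have psE : P [set w | A (M s w)] = ps%:E by exact: prob_fin.
  have psp : ps <= p by rewrite -lee_fin -psE Ap.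
  have mX : measurable_fun setT (fun w => (A (M s w))%:R : R).
    exact: (measurableT_comp mA' (mM s)).
  apply: (@le_trans _ _ (\int[P]_w (expR (t * ((A (M s w))%:R - ps)))%:E)%E).
    apply: le_integral_fin => [||w].
    - apply: measurable_fun_expR; apply: measurable_funM => //.
      exact: measurable_funB.
    - apply: measurable_fun_expR; apply: measurable_funM => //.
      exact: measurable_funB.
    - by rewrite expR_ge0/= ler_expR ler_wpM2l// lerD2l lerN2.
  apply: hoeffding_mgf => // [w|]; first by case: (A _); rewrite lexx ler01.
  by rewrite integral_natr_bool.
have := expR_sum_price_le n mh (expR_ge0 (t ^+ 2 / 8)) step.
have mS : measurable_fun setT (fun w => \sum_(1 <= s < n.+1) h (M s w)).
  by apply: measurable_sum_nat => s _; apply/measurableT_comp.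
have -> : (\int[P]_w (expR (t * (\sum_(1 <= s < n.+1) (A (M s w))%:R
      - n%:R * (p + 3 / 2 * e))))%:E)%E =
    (\int[P]_w (expR (- (9 * (n%:R * e ^+ 2))) *
       expR (t * \sum_(1 <= s < n.+1) h (M s w)))%:E)%E.
  apply: eq_integral => w _; rewrite -expRD; congr (expR _)%:E.
  by rewrite /h sumrB sumr_const_nat subn1/= -[p *+ n]mulr_natl /t; field.
move=> le; rewrite integral_finZ ?expR_ge0//; last first.
  by apply: measurable_fun_expR; exact: measurable_funM.
apply: (@le_trans _ _ ((expR (- (9 * (n%:R * e ^+ 2))))%:E
    * (expR (t ^+ 2 / 8) ^+ n)%:E)%E).
  by rewrite lee_wpmul2l// lee_fin expR_ge0.
rewrite -EFinM -expRM_natl -expRD lee_fin ler_expR /t.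
by rewrite le_eqVlt; apply/orP; left; apply/eqP; field.
Qed.

(** The 2 taken off the threshold 2 n e leaves 2/n per average for rounding to the grid and costs 12
    e in the exponent, the tilt being 6 e. The rest is n times the bound of [price_mgf_bound], with
    8 e^2 - 12 e^2 = - 4 e^2. *)
Lemma expected_price_grid_le (b g e : R) n :
  0 <= g <= b -> b < v -> v <= 1 -> util v F g <= util v F b ->
  0 <= e <= 1 / 20 ->
  (\int[P]_w (expR (6 * e * (\sum_(1 <= s < n.+1)
       ((v - g) * (M s w < g)%R%:R - (v - b) * (M s w <= b)%R%:R
         + e * ((M s w <= b)%R%:R - (M s w < g)%R%:R))
       - (2 * n%:R * e - 2))))%:E
   <= (expR (- (4 * (n%:R * e ^+ 2)) + 234 * (n%:R * e ^+ 3) + 12 * e))%:E)%E.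
Proof.
move=> /andP[g0 gb] bv v1 Ug /andP[e0 e1]; set t := 6 * e.
pose h (y : R) : R := (v - g) * (y < g)%R%:R - (v - b) * (y <= b)%R%:R
  + e * ((y <= b)%R%:R - (y < g)%R%:R).
have mlt : measurable_fun setT (fun y : R => (y < g)%R%:R : R).
  by apply: measurable_natr_bool; exact: measurable_fun_ltr.
have mle : measurable_fun setT (fun y : R => (y <= b)%R%:R : R).
  by apply: measurable_natr_bool; exact: measurable_fun_ler.
have mh : measurable_fun setT h.
  apply: measurable_funD; first by apply: measurable_funB; exact: measurable_funM.
  by apply: measurable_funM => //; exact: measurable_funB.
pose c := expR (8 * e ^+ 2 + 234 * e ^+ 3).
have step s : (1 <= s)%N -> (\int[P]_w (expR (t * h (M s w)))%:E <= c%:E)%E.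
  move=> s1; pose p := fine (P [set w | M s w < g]).
  have pE : P [set w | M s w < g] = p%:E.
    by apply: prob_fin; exact: measurable_price_lt.
  have qE := prob_price_ge_le s1 gb; rewrite -/p in qE.
  have rE : P [set w | b < M s w] = (1 - F b)%:E.
    rewrite (_ : [set w | b < M s w] = ~` [set w | M s w <= b]).
      by rewrite probability_setC ?cdfM//; exact: measurable_price_le.
    by apply/seteqP; split=> w /=; [move=> h1; apply/negP; rewrite -ltNge
      |move/negP; rewrite -ltNge].
  have p0 : 0 <= p by exact: fine_ge0.
  have q0 : 0 <= F b - p by rewrite -lee_fin -qE.
  have pFg : p <= F g.
    rewrite -lee_fin -pE -(cdfM _ s1); apply: le_measure; rewrite ?inE.
    - exact: measurable_price_lt.
    - exact: measurable_price_le.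
    - by move=> w /= /ltW.
  have Fb1 := cdf_le1 mM cdfM b.
  rewrite /util in Ug.
  have pU : (v - g) * p <= (v - g) * F g by rewrite ler_wpM2l//; lra.
  (* On M < g, g <= M <= b and M > b, the variable equals b - g, e - (v - b) and 0. With p and q the
     masses of the first two events, [Ug] yields p (b - g) <= q (v - b), as [price_mgf_bound]
     asks. *)
  have -> : (\int[P]_w (expR (t * h (M s w)))%:E)%E =
      (\int[P]_w (expR (t * (b - g)) * (M s w < g)%R%:R +
         (expR (t * (e - (v - b))) * ((g <= M s w) && (M s w <= b))%:R
          + (b < M s w)%R%:R))%:E)%E.
    apply: eq_integral => w _; congr (_%:E); rewrite /h.
    have [Mg|gM] := ltP (M s w) g.
      have Mb : M s w <= b by rewrite (le_trans (ltW Mg)).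
      rewrite Mb ltNge Mb/= !mulr0 !addr0 !mulr1 subrr mulr0 addr0.
      by congr expR; ring.
    rewrite mulr0 add0r mulr0 add0r; have [Mb|bM] /= := leP (M s w) b.
      by rewrite addr0 subr0 !mulr1; congr expR; ring.
    by rewrite !mulr0 subr0 oppr0 !mulr0 !add0r mulr0 expR0.
  have mb1 : measurable_fun setT (fun w => (M s w < g)%R%:R : R).
    by apply: measurable_natr_bool; exact: measurable_fun_ltr.
  have mb3 : measurable_fun setT (fun w => (b < M s w)%R%:R : R).
    by apply: measurable_natr_bool; exact: measurable_fun_ltr.
  have mb2 : measurable_fun setT (fun w => ((g <= M s w) && (M s w <= b))%:R : R).
    apply: measurable_natr_bool; apply: measurable_and; exact: measurable_fun_ler.
  have mI : measurable [set w | (g <= M s w) && (M s w <= b)].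
    rewrite (_ : [set w | _] = [set w | g <= M s w] `&` [set w | M s w <= b]).
      by apply: measurableI; [exact: measurable_price_ge|exact: measurable_price_le].
    by apply/seteqP; split=> w /= => [/andP[]|[-> ->]].
  rewrite integral_finD; last 4 first.
  - exact: measurable_funM.
  - by apply: measurable_funD => //; exact: measurable_funM.
  - by move=> w; rewrite mulr_ge0 ?expR_ge0.
  - by move=> w; rewrite addr_ge0// mulr_ge0 ?expR_ge0.
  rewrite integral_finD; last 4 first.
  - exact: measurable_funM.
  - exact: mb3.
  - by move=> w; rewrite mulr_ge0 ?expR_ge0.
  - by move=> w.
  rewrite !integral_finZ ?expR_ge0//.
  rewrite !integral_natr_bool//; last 2 first.
  - exact: measurable_price_gt.
  - exact: measurable_price_lt.
  rewrite pE qE rE -!EFinM -!EFinD lee_fin addrA.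
  rewrite [X in _ + X](_ : _ = 1 - p - (F b - p)); last by ring.
  apply: price_mgf_bound => //; lra.
have := expR_sum_price_le n mh (expR_ge0 _) step.
have mS : measurable_fun setT (fun w => \sum_(1 <= s < n.+1) h (M s w)).
  by apply: measurable_sum_nat => s _; apply/measurableT_comp.
have -> : (\int[P]_w (expR (t * (\sum_(1 <= s < n.+1)
       ((v - g) * (M s w < g)%R%:R - (v - b) * (M s w <= b)%R%:R
         + e * ((M s w <= b)%R%:R - (M s w < g)%R%:R))
       - (2 * n%:R * e - 2))))%:E)%E =
    (\int[P]_w (expR (- (t * (2 * n%:R * e - 2))) *
       expR (t * \sum_(1 <= s < n.+1) h (M s w)))%:E)%E.
  by apply: eq_integral => w _; rewrite -expRD; congr (expR _)%:E; rewrite /h; ring.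
move=> le; rewrite integral_finZ ?expR_ge0//; last first.
  by apply: measurable_fun_expR; exact: measurable_funM.
apply: (@le_trans _ _ ((expR (- (t * (2 * n%:R * e - 2))))%:E
    * (c ^+ n)%:E)%E).
  by rewrite lee_wpmul2l// lee_fin expR_ge0.
rewrite -EFinM /c -expRM_natl -expRD lee_fin ler_expR /t.
rewrite le_eqVlt; apply/orP; left; apply/eqP; ring.
Qed.

(** Bad events are handled through dominating random variables [G] of summable
    expectation, so that neither Markov's inequality nor the measurability of
    [Q] is needed. *)
Definition fails_rarely (Q : nat -> Omega -> Prop) : Prop :=
  exists K theta : R, [/\ 0 <= K, 1 < theta & forall n, (0 < n)%N ->
    exists G : Omega -> R, [/\ measurable_fun setT G, forall w, 0 <= G w,
      (\int[P]_w (G w)%:E <= (K * expR (- (theta * ln n%:R)))%:E)%E &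
      forall w, Q n w \/ 1 <= G w]].

Lemma fails_rarely_imp (Q Q' : nat -> Omega -> Prop) :
  (forall n w, (0 < n)%N -> Q n w -> Q' n w) -> fails_rarely Q -> fails_rarely Q'.
Proof.
move=> QQ' [K [th [K0 th1 H]]]; exists K, th; split=> // n n0.
have [G [mG G0 EG QG]] := H n n0; exists G; split=> // w.
by have [/(QQ' _ _ n0)|] := QG w; [left|right].
Qed.

Lemma fails_rarely_and (Q Q' : nat -> Omega -> Prop) :
  fails_rarely Q -> fails_rarely Q' -> fails_rarely (fun n w => Q n w /\ Q' n w).
Proof.
move=> [K [th [K0 th1 H]]] [K' [th' [K'0 th'1 H']]].
exists (K + K'), (Num.min th th'); split=> [||n n0].
- exact: addr_ge0.
- by rewrite lt_min th1.
have [G [mG G0 EG QG]] := H n n0; have [G' [mG' G'0 EG' QG']] := H' n n0.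
exists (fun w => G w + G' w); split.
- exact: measurable_funD.
- by move=> w; rewrite addr_ge0.
- rewrite integral_finD//; apply: (le_trans (leeD EG EG')).
  have L0 := @ln_nat_ge0 R n.
  rewrite -EFinD lee_fin mulrDl; apply: lerD; rewrite ler_wpM2l// ler_expR lerN2.
    by rewrite ler_wpM2r// ge_min lexx.
  by rewrite ler_wpM2r// ge_min lexx orbT.
- move=> w; have := G0 w; have := G'0 w.
  by have [?|?] := QG w; have [?|?] := QG' w; [left|right; lra..].
Qed.

Lemma fails_rarely_eventually (Q : nat -> Omega -> Prop) (K th : R) (n1 : nat) :
  0 <= K -> 1 < th ->
  (forall n, (0 < n)%N -> (n1 <= n)%N ->
    exists G : Omega -> R, [/\ measurable_fun setT G, forall w, 0 <= G w,
      (\int[P]_w (G w)%:E <= (K * expR (- (th * ln n%:R)))%:E)%E &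
      forall w, Q n w \/ 1 <= G w]) -> fails_rarely Q.
Proof.
(* Below n1 the constant 1 is a dominating variable; the added n1^th makes its integral
   admissible. *)
move=> K0 th1 H; exists (K + expR (th * ln n1%:R)), th; split=> // [|n n0].
  by rewrite addr_ge0// expR_ge0.
have [n1n|nn1] := leqP n1 n.
  have [G [mG G0 EG QG]] := H n n0 n1n; exists G; split=> //.
  apply: (le_trans EG); rewrite lee_fin ler_wpM2r ?expR_ge0// lerDl.
  exact: expR_ge0.
exists (fun=> 1); split=> [||| w]; [exact: measurable_cst|by []| |by right].
rewrite integral_prob_cst lee_fin mulrDl -expRD ler_wpDl//.
  by rewrite mulr_ge0 ?expR_ge0.
rewrite -[leLHS]expR0 ler_expR subr_ge0 ler_wpM2l//; first lra.
by rewrite ler_ln ?posrE ?ltr0n ?(leq_trans n0 (ltnW nn1))// ler_nat ltnW.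
Qed.

Lemma fails_rarely_ge (n1 : nat) : fails_rarely (fun n _ => (n1 <= n)%N).
Proof.
apply: (fails_rarely_eventually (K := 0) (th := 2) (n1 := n1)) => //.
  by lra.
move=> n n0 n1n; exists (fun=> 0); split=> //; last by left.
by rewrite integral_prob_cst mul0r.
Qed.

Lemma ler_sum_term (m n j : nat) (h : nat -> R) : (m <= j < n)%N ->
  (forall i, 0 <= h i) -> h j <= \sum_(m <= i < n) h i.
Proof.
move=> mjn h0; rewrite (bigD1_seq j) ?mem_index_iota ?iota_uniq//=.
by rewrite lerDl sumr_ge0.
Qed.

(** A union bound: summing n dominating variables costs a factor n, so the exponent drops by one and
    has to start above 2. *)
Lemma fails_rarely_grid (Q : nat -> nat -> Omega -> Prop) (K th : R) (n1 : nat)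
    (G : nat -> nat -> Omega -> R) :
  0 <= K -> 2 < th ->
  (forall n k, measurable_fun setT (G n k)) -> (forall n k w, 0 <= G n k w) ->
  (forall n k, (0 < n)%N -> (n1 <= n)%N ->
     (\int[P]_w (G n k w)%:E <= (K * expR (- (th * ln n%:R)))%:E)%E) ->
  (forall n k w, (0 < n)%N -> (n1 <= n)%N -> Q n k w \/ 1 <= G n k w) ->
  fails_rarely (fun n w => forall k, (0 < k <= n)%N -> Q n k w).
Proof.
move=> K0 th2 mG G0 EG QG.
apply: (fails_rarely_eventually (K := K) (th := th - 1) (n1 := n1)) => //.
  lra.
move=> n n0 n1n; exists (fun w => \sum_(1 <= k < n.+1) G n k w); split.
- by apply: measurable_sum_nat => k _.
- by move=> w; apply: sumr_ge0.
- rewrite integral_fin_sum//.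
  apply: (@le_trans _ _ (\sum_(1 <= k < n.+1)
      (K * expR (- (th * ln n%:R)))%:E)%E).
    by rewrite lee_sum// => k _; exact: EG.
  rewrite sumEFin lee_fin sumr_const_nat subn1/= -[(K * _) *+ _]mulr_natl mulrCA ler_wpM2l//.
  rewrite -{1}(expR_ln_nat n0) -expRD ler_expR.
  by rewrite le_eqVlt; apply/orP; left; apply/eqP; ring.
- move=> w; have [G1|G1] := leP 1 (\sum_(1 <= k < n.+1) G n k w); [by right|left].
  move=> k kn; have [//|Gk] := QG n k w n0 n1n.
  have := @ler_sum_term 1 n.+1 k (fun k => G n k w) kn (fun k => G0 n k w).
  by move=> /(le_lt_trans)/(_ G1); rewrite ltNge Gk.
Qed.

(** * Rare failure of the confidence bounds *)

Lemma vhat_fails_rarely : 1 < gamma ->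
  fails_rarely (fun n w => `|vhat gamma (vs w) (ms w) n - v|
    < radius gamma (vs w) (ms w) n).
Proof.
move=> g1.
(* The ratio b = 1 + eta is such that peeling lowers the exponent from gamma to th' = (1 + gamma) /
   2. The number of scales, of order ln n, is bounded by a multiple of n^rho, and th = th' - rho
   still exceeds 1. *)
pose eta := Num.sqrt ((gamma - 1) / (2 * gamma)).
have eta2 : eta ^+ 2 = (gamma - 1) / (2 * gamma).
  by rewrite sqr_sqrtr// divr_ge0; lra.
have eta0 : 0 < eta by rewrite sqrtr_gt0 divr_gt0; lra.
pose b := 1 + eta; have b1 : 1 < b by rewrite ltrDl.
have lb : 0 < ln b by rewrite ln_gt0.
pose rho := (gamma - 1) / 4; have rho0 : 0 < rho by rewrite /rho; lra.
pose th := (3 + gamma) / 4.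
pose th' := (1 + gamma) / 2.
pose K := 2 * (rho^-1 / ln b + 1).
have K0 : 0 <= K.
  by rewrite mulr_ge0// addr_ge0// divr_ge0 ?invr_ge0// ltW.
apply: (fails_rarely_eventually (K := K) (th := th) (n1 := 0)) => //.
  by rewrite /th; lra.
move=> n n0 _; set L := ln (n%:R : R); have L0 : 0 <= L by exact: ln_nat_ge0.
pose c := Num.sqrt (gamma * L / 2).
have c2 : c ^+ 2 = gamma * L / 2.
  by rewrite sqr_sqrtr// divr_ge0// mulr_ge0//; lra.
have c0 : 0 <= c by exact: sqrtr_ge0.
pose t j := 4 * c / b ^+ j.
pose Z (x : R) w := expR (x * win_deviation w n
  - x ^+ 2 / 8 * nwins gamma (vs w) (ms w) n).
have mN : measurable_fun setT (fun w => nwins gamma (vs w) (ms w) n).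
  by apply: measurable_nwins => // s /andP[s0 _]; exact: measurable_bidRV.
have mS : measurable_fun setT (fun w => win_deviation w n).
  apply: measurable_sum_nat => s /andP[s0 _]; apply: measurable_funM.
    exact: measurable_funB.
  apply: measurable_natr_bool; apply: measurable_fun_ler => //.
  exact: measurable_bidRV.
have mZ x : measurable_fun setT (Z x).
  apply: measurable_fun_expR; apply: measurable_funB; exact: measurable_funM.
have Z0 x w : 0 <= Z x w by exact: expR_ge0.
pose J := (Num.truncn (L / ln b)).+1.
(* One exponential per scale of sqrt N and per sign of the deviation. Where the confidence bound
   fails, the term of the actual scale and sign alone reaches [expR (th' * L)]. *)
pose G w := expR (- (th' * L)) * \sum_(0 <= j < J) (Z (t j) w + Z (- t j) w).
have mG' : measurable_fun setT (fun w => \sum_(0 <= j < J) (Z (t j) w + Z (- t j) w)).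
  by apply: measurable_sum_nat => j _; exact: measurable_funD.
have G'0 w : 0 <= \sum_(0 <= j < J) (Z (t j) w + Z (- t j) w).
  by apply: sumr_ge0 => j _; rewrite addr_ge0.
exists G; split.
- exact: measurable_funM.
- by move=> w; rewrite mulr_ge0 ?expR_ge0.
- rewrite integral_finZ ?expR_ge0// integral_fin_sum; last 2 first.
  + by move=> j _; exact: measurable_funD.
  + by move=> j w _; rewrite addr_ge0.
  apply: (@le_trans _ _ ((expR (- (th' * L)))%:E * (J%:R * 2)%:E)%E).
    rewrite lee_wpmul2l ?lee_fin ?expR_ge0//.
    apply: (@le_trans _ _ (\sum_(0 <= j < J) 2%:E)%E).
      rewrite lee_sum// => j _; rewrite integral_finD//.
      by rewrite (_ : 2%:E = 1%:E + 1%:E)%E ?leeD ?supermartingale_le1// -EFinD.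
    by rewrite sumEFin lee_fin sumr_const_nat subn0 -[_ *+ J]mulr_natl lexx.
  rewrite -EFinM lee_fin.
  have JL : J%:R <= L / ln b + 1.
    by rewrite /J -natr1 lerD2r truncn_le// divr_ge0// ltW.
  have LE : L <= rho^-1 * expR (rho * L) by exact: ln_le_expR.
  have E1 : 1 <= expR (rho * L) by rewrite -expR0 ler_expR mulr_ge0// ltW.
  have JE : J%:R <= (rho^-1 / ln b + 1) * expR (rho * L).
    apply: (le_trans JL); rewrite mulrDl mul1r lerD// mulrAC ler_wpM2r//.
    by rewrite invr_ge0 ltW.
  have -> : - (th * L) = - (th' * L) + rho * L.
    by rewrite /th /th' /rho; field.
  rewrite expRD [leRHS]mulrCA ler_wpM2l ?expR_ge0// /K.
  by rewrite [leLHS]mulrC -mulrA ler_wpM2l.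
move=> w; pose N := nwins gamma (vs w) (ms w) n.
set Vh := vhat gamma (vs w) (ms w) n.
have [|dev] := ltP `|Vh - v| (radius gamma (vs w) (ms w) n); [by left|right].
have N1 : 1 <= N by apply: nwins_ge1 => // s s1; exact: M01.
have N0 : 0 < N by lra.
have Nn : N <= n%:R by exact: nwins_le.
pose r := Num.sqrt N.
have r2 : r ^+ 2 = N by rewrite sqr_sqrtr// ltW.
have r1 : 1 <= r by rewrite -sqrtr1 ler_wsqrtr.
have r0 : 0 < r by lra.
have SE : win_deviation w n = N * (Vh - v).
  rewrite mulrBr /Vh /vhat -/N mulrC divfK ?gt_eqF//.
  rewrite /win_deviation -[N * v]mulrC mulr_sumr -sumrB.
  by apply: eq_bigr => s _; rewrite mulrBl.
have radE : radius gamma (vs w) (ms w) n = c / r.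
  rewrite /radius -/N -/L /c /r -sqrtrV ?(ltW N0)// -sqrtrM.
    by rewrite invfM mulrA.
  by rewrite divr_ge0// mulr_ge0//; lra.
have devS : c * r <= `|win_deviation w n|.
  rewrite SE normrM gtr0_norm//.
  apply: (@le_trans _ _ (N * (c / r))); last by rewrite ler_wpM2l ?(ltW N0)// -radE.
  by rewrite -r2 expr2 mulrCA -mulrA divff ?gt_eqF// mulr1 mulrC.
have [j jr jL] := exists_geometric_scale b1 r1.
have jJ : (0 <= j < J)%N.
  rewrite /J ltnS truncn_ge_nat ?divr_ge0 ?(ltW lb)//.
  apply: (le_trans jL); rewrite ler_wpM2r ?invr_ge0 ?(ltW lb)//.
  rewrite ler_ln ?posrE ?ltr0n//; apply: le_trans Nn.
  by rewrite -r2 expr2 ler_peMr// ltW.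
have xj : 0 < b ^+ j by rewrite exprn_gt0//; lra.
have jr' : b ^+ j <= r < b * b ^+ j by rewrite -exprS.
have pe := peeling_exponent c0 xj jr' devS; rewrite c2 r2 in pe.
have {}pe : th' * L <= t j * `|win_deviation w n| - t j ^+ 2 / 8 * N.
  apply: le_trans pe; rewrite /b [1 + eta - 1]addrAC subrr add0r eta2.
  rewrite le_eqVlt; apply/orP; left; apply/eqP; rewrite /th'; field.
  by rewrite gt_eqF//; lra.
have ZZ : expR (th' * L) <= Z (t j) w + Z (- t j) w.
  have [S0|S0] := leP 0 (win_deviation w n).
    rewrite ger0_norm// in pe.
    by apply: (@le_trans _ _ (Z (t j) w)); [rewrite ler_expR|rewrite lerDl].
  rewrite ltr0_norm// in pe.
  apply: (@le_trans _ _ (Z (- t j) w)); last by rewrite lerDr.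
  by rewrite ler_expR sqrrN mulNr -mulrN.
rewrite /G [leLHS](_ : 1 = expR (- (th' * L)) * expR (th' * L)); last first.
  by rewrite -expRD addNr expR0.
rewrite ler_wpM2l ?expR_ge0//.
apply: (le_trans ZZ).
exact: (@ler_sum_term 0 J j (fun i => Z (t i) w + Z (- t i) w) jJ
  (fun i => addr_ge0 (Z0 _ _) (Z0 _ _))).
Qed.

Local Notation e n := (Num.sqrt (gamma * ln (n%:R : R) / (2 * n%:R))).

Lemma sum_fhat n w b : (0 < n)%N ->
  \sum_(1 <= s < n.+1) (M s w < b)%R%:R = n%:R * fhat (ms w) n b.
Proof. by move=> n0; rewrite /fhat mulrC divfK// pnatr_eq0 -lt0n. Qed.

Lemma sum_fhat_right n w b : (0 < n)%N ->
  \sum_(1 <= s < n.+1) (M s w <= b)%R%:R = n%:R * fhat_right (ms w) n b.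
Proof. by move=> n0; rewrite /fhat_right mulrC divfK// pnatr_eq0 -lt0n. Qed.

Lemma conf_radius_sqr n : 0 <= gamma -> (0 < n)%N ->
  n%:R * e n ^+ 2 = gamma * ln n%:R / 2.
Proof.
move=> g0 n0; have nR : (0 : R) < n%:R by rewrite ltr0n.
rewrite sqr_sqrtr; last by rewrite divr_ge0 ?mulr_ge0 ?ln_nat_ge0 ?(ltW nR).
by field; rewrite gt_eqF.
Qed.

Lemma grid_fails_rarely b : 1 < gamma -> 0 <= b < v -> v <= 1 ->
  (forall g, 0 <= g <= b -> util v F g <= util v F b) ->
  fails_rarely (fun n w => forall k, (0 < k <= n)%N ->
    let g := Num.min b (k%:R / n%:R) in
    (v - g) * fhat (ms w) n g - (v - b) * fhat_right (ms w) n b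
      + e n * (fhat_right (ms w) n b - fhat (ms w) n g)
      <= 2 * e n - 2 / n%:R).
Proof.
move=> g1 /andP[b0 bv] v1 Ub; have g0 : 0 <= gamma by lra.
have [n1 n1P] := conf_radius_eventually g1.
pose gr n k : R := Num.min b (k%:R / n%:R).
have grP n k : 0 <= gr n k <= b.
  by rewrite le_min b0 divr_ge0//= ge_min lexx.
pose S n k w : R := \sum_(1 <= s < n.+1)
  ((v - gr n k) * (M s w < gr n k)%R%:R - (v - b) * (M s w <= b)%R%:R
    + e n * ((M s w <= b)%R%:R - (M s w < gr n k)%R%:R)).
pose G n k w : R := expR (6 * e n * (S n k w - (2 * n%:R * e n - 2))).
(* The exponent 4 n e^2 is 2 gamma ln n; K absorbs 234 n e^3, bounded by [conf_radius_cube], and 12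
   e, at most 1. *)
apply: (fails_rarely_grid (K := expR (234 * (gamma ^+ 3 + 1) + 1))
    (th := 2 * gamma) (n1 := n1) (G := G)).
- exact: expR_ge0.
- by lra.
- move=> n k; apply: measurable_fun_expR; apply: measurable_funM => //.
  apply: measurable_funB => //; apply: measurable_sum_nat => s _.
  have m1 : measurable_fun setT (fun w => (M s w < gr n k)%R%:R : R).
    by apply: measurable_natr_bool; exact: measurable_fun_ltr.
  have m2 : measurable_fun setT (fun w => (M s w <= b)%R%:R : R).
    by apply: measurable_natr_bool; exact: measurable_fun_ler.
  apply: measurable_funD; first by apply: measurable_funB; exact: measurable_funM.
  by apply: measurable_funM => //; exact: measurable_funB.
- by move=> n k w; exact: expR_ge0.
- move=> n k n0 n1n; have [_ e1 ne] := n1P n n1n.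
  have e0 : 0 <= e n by exact: sqrtr_ge0.
  have e01 : 0 <= e n <= 1 / 20 by rewrite e0.
  apply: (le_trans (expected_price_grid_le n (grP n k) bv v1 (Ub _ (grP n k)) e01)).
  rewrite conf_radius_sqr// lee_fin -expRD ler_expR.
  have := conf_radius_cube g0 n0.
  by lra.
- move=> n k w n0 n1n; have [_ e1 ne] := n1P n n1n.
  have nR : (0 : R) < n%:R by rewrite ltr0n.
  have e0 : 0 < e n by rewrite -(pmulr_rgt0 _ nR); lra.
  have [|G1] := leP 1 (G n k w); [by right|left].
  move: G1; rewrite /G -[ltRHS]expR0 ltr_expR pmulr_rlt0 ?mulr_gt0// => Sn /=.
  have SE : S n k w = n%:R *
    ((v - gr n k) * fhat (ms w) n (gr n k) - (v - b) * fhat_right (ms w) n b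
      + e n * (fhat_right (ms w) n b - fhat (ms w) n (gr n k))).
    rewrite /S big_split/= sumrB -!mulr_sumr sumrB sum_fhat// sum_fhat_right//.
    by ring.
  rewrite SE in Sn; rewrite -/(gr n k) -(ler_pM2l nR) [leRHS]mulrBr.
  rewrite (_ : n%:R * (2 / n%:R) = 2); last by field; rewrite gt_eqF.
  by rewrite ltW//; move: Sn; lra.
Qed.

Lemma price_event_lt n w (A : R -> bool) (p : R) :
  expR (6 * e n * (\sum_(1 <= s < n.+1) (A (M s w))%:R
      - n%:R * (p + 3 / 2 * e n))) < 1 ->
  \sum_(1 <= s < n.+1) (A (M s w))%:R < n%:R * (p + 3 / 2 * e n).
Proof.
rewrite -[ltRHS]expR0 ltr_expR => h; rewrite -subr_lt0.
(* The radius vanishes for instance at n = 1, where ln n = 0; the exponential is then 1, against the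
   hypothesis. *)
have [e0|e0] := leP (e n) 0; last by rewrite -(pmulr_rlt0 _ (_ : 0 < 6 * e n)) ?mulr_gt0.
have e00 : e n = 0 by apply/eqP; rewrite eq_le e0 sqrtr_ge0.
by move: h; rewrite e00 mulr0 mul0r ltxx.
Qed.

Lemma measurable_price_event n (A : R -> bool) (p : R) :
  measurable_fun setT A ->
  measurable_fun setT (fun w => expR (6 * e n *
    (\sum_(1 <= s < n.+1) (A (M s w))%:R - n%:R * (p + 3 / 2 * e n)))).
Proof.
move=> mA; apply: measurable_fun_expR; apply: measurable_funM => //.
apply: measurable_funB => //; apply: measurable_sum_nat => s _.
by apply: measurable_natr_bool; apply/measurableT_comp.
Qed.

Lemma expected_price_event_conf_le n (A : R -> bool) (p : R) :
  1 < gamma -> (0 < n)%N -> measurable_fun setT A ->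
  (forall s, (1 <= s)%N -> (P [set w | A (M s w)] <= p%:E)%E) ->
  (\int[P]_w (expR (6 * e n * (\sum_(1 <= s < n.+1) (A (M s w))%:R
      - n%:R * (p + 3 / 2 * e n))))%:E
    <= (1 * expR (- (9 / 4 * gamma * ln n%:R)))%:E)%E.
Proof.
move=> g1 n0 mA Ap.
apply: (le_trans (expected_price_event_le n mA (sqrtr_ge0 _) Ap)).
rewrite conf_radius_sqr//; last by lra.
rewrite mul1r lee_fin ler_expR; lra.
Qed.

Lemma cdf_fails_rarely b : 1 < gamma ->
  fails_rarely (fun n w => F b - fhat_right (ms w) n b <= 8 / 5 * e n).
Proof.
move=> g1; pose A (y : R) := b < y.
have mA : measurable_fun setT A by exact: measurable_fun_ltr.
apply: (fails_rarely_eventually (K := 1) (th := 9 / 4 * gamma) (n1 := 0)) => //.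
  by lra.
move=> n n0 _; pose G w := expR (6 * e n *
  (\sum_(1 <= s < n.+1) (A (M s w))%:R - n%:R * (1 - F b + 3 / 2 * e n))).
exists G; split.
- exact: measurable_price_event.
- by move=> w; exact: expR_ge0.
- apply: expected_price_event_conf_le => // s s1.
  rewrite (_ : [set w | A (M s w)] = ~` [set w | M s w <= b]).
    by rewrite probability_setC ?cdfM//; exact: measurable_price_le.
  by apply/seteqP; split=> w /=; rewrite /A; [move=> h1; apply/negP; rewrite -ltNge
      |move/negP; rewrite -ltNge].
move=> w; have nR : (0 : R) < n%:R by rewrite ltr0n.
have [|G1] := leP 1 (G w); [by right|left].
have Aw := price_event_lt G1.
have : \sum_(1 <= s < n.+1) (A (M s w))%:R = n%:R * (1 - fhat_right (ms w) n b) :> R.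
  rewrite mulrBr mulr1 -sum_fhat_right//.
  rewrite (_ : n%:R = \sum_(1 <= s < n.+1) 1); last by rewrite sumr_const_nat subn1.
  rewrite -sumrB; apply: eq_bigr => s _; rewrite /A.
  by case: leP => _; rewrite ?subrr ?subr0.
move=> AE; rewrite AE ltr_pM2l// in Aw.
by have := sqrtr_ge0 (gamma * ln (n%:R : R) / (2 * n%:R)); lra.
Qed.

(** Uniformity in x is required because x will be the random bid. Prices in (b, x) lie below the
    quantile of level k/n just above F x, which overshoots F x by at most 1/n <= e/10; so 8/5 is 3/2
    + 1/10. *)
Lemma interval_fails_rarely b : 1 < gamma ->
  fails_rarely (fun n w => forall x, 0 <= x <= 1 -> b < x ->
    fhat (ms w) n x - fhat_right (ms w) n b <= F x - F b + 8 / 5 * e n).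
Proof.
move=> g1; have [n1 n1P] := conf_radius_eventually g1.
have /choice[q qP] : forall nk : nat * nat, exists g : R,
    (forall s, (1 <= s)%N -> (P [set w | (M s w < g)%R] <= (nk.2%:R / nk.1%:R)%:E)%E) /\
    (forall x, 0 <= x <= 1 -> F x < nk.2%:R / nk.1%:R -> x <= g).
  move=> nk; apply: (prob_lt_le_quantile mM M01 cdfM); exact: divr_ge0.
pose A n k (y : R) := (b < y) && (y < q (n, k)).
have mA n k : measurable_fun setT (A n k).
  by apply: measurable_and; exact: measurable_fun_ltr.
pose p n k : R := Num.max 0 (k%:R / n%:R - F b).
pose G n k w : R := expR (6 * e n * (\sum_(1 <= s < n.+1) (A n k (M s w))%:R
  - n%:R * (p n k + 3 / 2 * e n))).
pose Q n k w := \sum_(1 <= s < n.+1) (A n k (M s w))%:R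
   < n%:R * (p n k + 3 / 2 * e n).
have Qr : fails_rarely (fun n w => forall k, (0 < k <= n)%N -> Q n k w).
  apply: (fails_rarely_grid (K := 1) (th := 9 / 4 * gamma) (n1 := 0) (G := G)) => //.
  - by lra.
  - by move=> n k; exact: measurable_price_event.
  - by move=> n k w; exact: expR_ge0.
  - move=> n k n0 _; apply: expected_price_event_conf_le => // s s1.
    by apply: (prob_price_gt_lt_le _ s1); have [+ _] := qP (n, k); exact.
  - move=> n k w _ _; have [|G1] := leP 1 (G n k w); [by right|left].
    exact: price_event_lt G1.
have late := fails_rarely_ge n1.
apply: fails_rarely_imp (fails_rarely_and late (fails_rarely_and Qr (cdf_fails_rarely b g1))).
move=> n w n0 [n1n [Qw Fw]] x x01 bx.
have [_ e1 ne] := n1P n n1n.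
have nR : (0 : R) < n%:R by rewrite ltr0n.
have Fx0 := cdf_ge0 cdfM x; have Fx1 := cdf_le1 mM cdfM x.
(* At F x = 1 no level k/n with k <= n exceeds F x; there [fhat] is at most 1 and the estimate at b
   alone suffices. *)
have [Fx|Fx] := leP 1 (F x).
  by have := fhat_le1 (ms w) n x; lra.
have xn : 0 <= F x * n%:R by rewrite mulr_ge0// ltW.
have /andP[k1 k2] := truncn_itv xn.
set k := (Num.truncn (F x * n%:R)).+1 in k1 k2.
have kn : (0 < k <= n)%N.
  rewrite /= -(ltr_nat R); apply: (le_lt_trans k1).
  by rewrite -ltr_pdivlMr// divff ?gt_eqF.
have Fk : F x < k%:R / n%:R by rewrite ltr_pdivlMr.
have kF : k%:R / n%:R <= F x + n%:R^-1.
  rewrite ler_pdivrMr// mulrDl mulVf ?gt_eqF//.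
  by rewrite /k -natr1 lerD2r.
have [_ /(_ x x01 Fk) xq] := qP (n, k).
have AE : \sum_(1 <= s < n.+1) (A n k (M s w))%:R =
    n%:R * (fhat (ms w) n (q (n, k)) - fhat_right (ms w) n b) :> R.
  rewrite mulrBr -sum_fhat// -sum_fhat_right// -sumrB; apply: eq_bigr => s _.
  rewrite /A; have [Mb|bM] /= := leP (M s w) b; last by rewrite subr0.
  by rewrite (le_lt_trans Mb)/= ?subrr// (lt_le_trans bx).
have := Qw k kn; rewrite /Q AE ltr_pM2l//.
have bF : F b <= F x by apply: (cdf_homo mM cdfM); exact: ltW.
rewrite /p max_r; last by lra.
have := fhat_le (ms w) n xq.
have : n%:R^-1 <= e n / 10.
  by rewrite -(ler_pM2l nR) divff ?gt_eqF//; lra.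
by lra.
Qed.

(** * Expected regret of one round *)

Lemma mean_itv : 0 <= v <= 1.
Proof.
have V1 : (\int[P]_w (V 1%N w)%:E = v%:E)%E by exact: mean_V.
rewrite -!lee_fin -V1; apply/andP; split.
  by apply: integral_ge0 => w _; rewrite lee_fin; have /andP[] := V01 w (leqnn 1).
rewrite -(integral_prob_cst P 1); apply: le_integral_fin => // w.
exact: V01.
Qed.

Lemma conf_radius_le_radius n w : 0 <= gamma -> (0 < n)%N ->
  e n <= radius gamma (vs w) (ms w) n.
Proof.
move=> g0 n0; have nR : (0 : R) < n%:R by rewrite ltr0n.
have N1 : 1 <= nwins gamma (vs w) (ms w) n.
  by apply: nwins_ge1 => // s; exact: M01.
have Nn := nwins_le gamma (vs w) (ms w) n.
apply: ler_wsqrtr; rewrite ler_wpM2l ?mulr_ge0 ?ln_nat_ge0//.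
rewrite lef_pV2 ?posrE ?mulr_gt0 ?ler_wpM2l//; lra.
Qed.

Lemma bid_le_ucb n w : (0 < n)%N -> bidRV gamma V M n.+1 w <=
  vhat gamma (vs w) (ms w) n + radius gamma (vs w) (ms w) n.
Proof.
move=> n0; rewrite /bidRV bidS//.
have [->|/set0P S0] := eqVneq (bid_set gamma (vs w) (ms w) n) set0.
  rewrite sup0 addr_ge0 ?sqrtr_ge0//; apply: vhat_ge0 => s; exact: V01.
by apply: ge_sup => // b [_ []].
Qed.

Lemma regret_fails_rarely : 1 < gamma -> 0 < F (bstar v F) ->
  fails_rarely (fun n w =>
    util_max v F - util v F (bidRV gamma V M n.+1 w) <=
    4 / F (bstar v F) * (radius gamma (vs w) (ms w) n * F (bidRV gamma V M n.+1 w))).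
Proof.
move=> g1 A0; have g0 : 0 <= gamma by lra.
have v01 := mean_itv; have /andP[v0 v1] := v01.
have F0 x := cdf_ge0 cdfM x; have F1 x := cdf_le1 mM cdfM x.
have [U0|U0] := leP (util_max v F) 0.
  have UE : util_max v F = 0.
    by apply/eqP; rewrite eq_le U0 (util_max_ge0 mM cdfM v01).
  apply: fails_rarely_imp (vhat_fails_rarely g1) => n w n0.
  rewrite ltr_norml => /andP[_ V2]; rewrite UE sub0r /util -mulNr opprB.
  have BV := bid_le_ucb w n0.
  set r := radius _ _ _ n in V2 BV *; set B := bidRV _ _ _ _ w in BV *.
  have r0 : 0 <= r by exact: sqrtr_ge0.
  (* The regret is (B - v) F(B) here, and B <= Vhat + r < v + 2 r. *)
  apply: (@le_trans _ _ (2 * r * F B)); first by rewrite ler_wpM2r//; lra.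
  rewrite -mulrA ler_wpM2r ?mulr_ge0//.
  rewrite ler_pdivlMr//; have := F1 (bstar v F); lra.
have [/andP[b0 bv] Ub] := bstar_argmax mM cdfM v01 U0.
set b := bstar v F in A0 b0 bv Ub *.
have Ug x : 0 <= x <= b -> util v F x <= util v F b.
  move=> /andP[x0 xb]; rewrite Ub; apply: (util_le_max mM cdfM v01).
  by rewrite x0; lra.
have b0v : 0 <= b < v by rewrite b0.
have [n1 n1P] := conf_radius_eventually g1.
have late := fails_rarely_ge n1.
apply: fails_rarely_imp (fails_rarely_and late (fails_rarely_and (vhat_fails_rarely g1)
  (fails_rarely_and (grid_fails_rarely g1 b0v v1 Ug)
  (fails_rarely_and (cdf_fails_rarely b g1) (interval_fails_rarely b g1))))).
move=> n w n0 [n1n [Vw [gridw [cw iw]]]].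
have [_ e1 ne] := n1P n n1n.
have nR : (0 : R) < n%:R by rewrite ltr0n.
have e0 : 0 < e n by rewrite -(pmulr_rgt0 _ nR); lra.
have er := conf_radius_le_radius w g0 n0.
have bB : b <= bidRV gamma V M n.+1 w.
  by apply: (bid_ge_of_grid _ _ n0 er ne b0v v1 Vw gridw) => s; [exact: V01|exact: M01].
rewrite -Ub; set B := bidRV _ _ _ _ w in bB *.
have B01 : 0 <= B <= 1 by exact: bid_itv.
apply: (regret_le_radius (tau := 8 / 5 * e n) _ _ n0 _ er b0v v1 Vw bB A0) => //.
- by move=> s; exact: V01.
- by move=> s; exact: M01.
- exact: lt_le_trans er.
- exact: (cdf_homo mM cdfM).
- by move=> BE; rewrite /B /bidRV BE.
- by apply/andP; split; lra.
- by move=> bB'; have := iw B B01 bB'; rewrite /B /bidRV; lra.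
Qed.

Lemma measurable_util_bid t : (1 <= t)%N ->
  measurable_fun setT (fun w => util v F (bidRV gamma V M t w)).
Proof.
move=> t1; have mB := measurable_bidRV t1.
apply: measurable_funM; first exact: measurable_funB.
have mF : measurable_fun setT F.
  by apply: nondecreasing_measurable => // x y xy; exact: (cdf_homo mM cdfM).
exact: (measurableT_comp mF mB).
Qed.

Lemma bid_itv_pos t w : (1 <= t)%N -> 0 <= bidRV gamma V M t w <= 1.
Proof. by case: t => // t _; exact: bid_itv. Qed.

Lemma expected_util_bid t : (1 <= t)%N ->
  ('E_P[fun w => util v F (bidRV gamma V M t w)] = (util_max v F)%:E -
   \int[P]_w (util_max v F - util v F (bidRV gamma V M t w))%:E)%E.
Proof.
move=> t1; have v01 := mean_itv.
pose D w := util_max v F - util v F (bidRV gamma V M t w).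
have mD : measurable_fun setT D.
  by apply: measurable_funB => //; exact: measurable_util_bid.
have D01 w : 0 <= D w <= 1.
  rewrite subr_ge0 (util_le_max mM cdfM v01) ?bid_itv_pos//=.
  by rewrite (regret_le1 mM cdfM v01)// bid_itv_pos.
have iD : P.-integrable setT (EFin \o D).
  apply: (@le_integrable _ _ _ P setT measurableT _ (cst 1%E)).
  - exact/measurable_EFinP.
  - move=> w _ /=; rewrite lee_fin ger0_norm ?normr1; by have /andP[] := D01 w.
  - by apply/integrableP; split => //; under eq_integral do rewrite abse1;
      rewrite integral_cst//= probability_setT mule1 ltry.
have iU : P.-integrable setT (cst (util_max v F)%:E).
  exact: finite_measure_integrable_cst.
rewrite unlock.
transitivity (\int[P]_w ((cst (util_max v F)%:E \- (EFin \o D)) w))%E.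
  by apply: eq_integral => w _ /=; rewrite -EFinB /D opprB addrC subrK.
by rewrite integralB// integral_cst//= probability_setT mule1.
Qed.

End auction.

(** * Summation over the rounds *)

Theorem theorem7 (R : realType) (d : measure_display) (Omega : measurableType d)
  (P : probability Omega R) (V M : nat -> Omega -> R) (v : R) (F : R -> R) (gamma : R) :
  (forall t, measurable_fun setT (V t)) ->
  (forall t, measurable_fun setT (M t)) ->
  (forall t w, (1 <= t)%N -> 0 <= V t w <= 1) ->
  (forall t w, (1 <= t)%N -> 0 <= M t w <= 1) ->
  (forall t, (1 <= t)%N -> forall A : set R, measurable A ->
      P (V t @^-1` A) = P (V 1%N @^-1` A)) ->
  ('E_P[V 1%N] = v%:E)%E ->
  (forall t b, (1 <= t)%N -> P [set w | M t w <= b] = (F b)%:E) ->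
  mutually_independent P [set i | (1 <= round_index i)%N] (VM V M) ->
  0 < F (bstar v F) ->
  1 < gamma ->
  exists C : R, forall T : nat, (1 <= T)%N ->
    (regret P v F gamma V M T <=
      ((4 * Num.sqrt 2 / F (bstar v F)) * Num.sqrt (gamma * ln (T%:R : R))
         * (Num.sqrt (T%:R : R) + 1) + C)%:E)%E.
Proof.
move=> mV mM V01 M01 idV meanV cdfM indVM A0 g1.
have g0 : 0 <= gamma by lra.
have [K [th [K0 th1 H]]] :=
  regret_fails_rarely mV mM V01 M01 idV meanV cdfM indVM g1 A0.
have v01 := mean_itv mV V01 idV meanV.
pose A := F (bstar v F).
pose rad n w := radius gamma (fun s => V s w) (fun s => M s w) n.
pose B t w := bidRV gamma V M t w.
pose D t w := util_max v F - util v F (B t w).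
pose rw n w := rad n w * (win gamma (fun s => V s w) (fun s => M s w) n.+1)%:R.
have mB t : (1 <= t)%N -> measurable_fun setT (B t).
  by move=> t1; exact: measurable_bidRV.
have mD t : (1 <= t)%N -> measurable_fun setT (D t).
  move=> t1; apply: measurable_funB => //.
  exact: (measurable_util_bid v gamma mV mM V01 M01 cdfM).
have D01 t w : (1 <= t)%N -> 0 <= D t w <= 1.
  move=> t1; have B01 := bid_itv_pos V M gamma w t1.
  by rewrite subr_ge0 (util_le_max mM cdfM v01)//= (regret_le1 mM cdfM v01).
have mrad n : measurable_fun setT (rad n).
  by apply: measurable_radius => // s /andP[s1 _]; exact: mB.
have rad0 n w : 0 <= rad n w by exact: sqrtr_ge0.
have mrw n : measurable_fun setT (rw n).
  apply: measurable_funM => //; apply: measurable_natr_bool.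
  by apply: measurable_fun_ler => //; exact: mB.
have rw0 n w : 0 <= rw n w by rewrite mulr_ge0.
have c0 : 0 <= 4 / A by rewrite divr_ge0// ltW.
have step n : (0 < n)%N -> (\int[P]_w (D n.+1 w)%:E <=
    (4 / A)%:E * \int[P]_w (rw n w)%:E + (K * expR (- (th * ln n%:R)))%:E)%E.
  move=> n0; have [G [mG G0 EG QG]] := H n n0.
  have mF : measurable_fun setT F.
    by apply: nondecreasing_measurable => // x y; exact: (cdf_homo mM cdfM).
  have mrF : measurable_fun setT (fun w => rad n w * F (B n.+1 w)).
    by apply: measurable_funM => //; exact: (measurableT_comp mF (mB _ (ltn0Sn n))).
  have rF0 w : 0 <= rad n w * F (B n.+1 w).
    by rewrite mulr_ge0// (cdf_ge0 cdfM).
  apply: (@le_trans _ _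
      (\int[P]_w (4 / A * (rad n w * F (B n.+1 w)) + G w)%:E)%E).
    apply: le_integral_fin.
    - exact: mD.
    - by apply: measurable_funD => //; exact: measurable_funM.
    move=> w; have /andP[-> D1] /= := D01 n.+1 w (ltn0Sn n).
    have [Qw|G1] := QG w; first by rewrite (le_trans Qw)// lerDl.
    by apply: (le_trans D1); rewrite (le_trans G1)// lerDr mulr_ge0.
  rewrite integral_finD//; last 2 first.
  - exact: measurable_funM.
  - by move=> w; rewrite mulr_ge0.
  rewrite integral_finZ// (expected_radius_win gamma mV mM V01 M01 cdfM indVM n0).
  exact: leeD.
have ED T : (1 <= T)%N ->
    regret P v F gamma V M T = (\sum_(1 <= t < T.+1) \int[P]_w (D t w)%:E)%E.
  move=> T1; rewrite /regret.
  have Dfin t : (1 <= t)%N ->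
      (\int[P]_w (D t w)%:E)%E = (fine (\int[P]_w (D t w)%:E))%:E.
    move=> t1; rewrite fineK// ge0_fin_numE; last first.
      by apply: integral_ge0 => w _; rewrite lee_fin; have /andP[] := D01 t w t1.
    apply: (@le_lt_trans _ _ 1%E); last exact: ltry.
    rewrite -(integral_prob_cst P 1); apply: le_integral_fin => //; first exact: mD.
    by move=> w; exact: D01.
  rewrite (eq_big_nat _ _ (F2 := fun t =>
      (util_max v F - fine (\int[P]_w (D t w)%:E))%:E)); last first.
    move=> t /andP[t1 _]; rewrite (expected_util_bid gamma mV mM V01 M01 idV meanV cdfM)//.
    by rewrite -/(D t _) EFinB -Dfin.
  rewrite [RHS](eq_big_nat _ _ (F2 := fun t => (fine (\int[P]_w (D t w)%:E))%:E)).
    rewrite !sumEFin -EFinB; congr (_%:E).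
    rewrite sumrB sumr_const_nat subn1/= -[util_max v F *+ T]mulr_natl.
    by rewrite opprB addrC subrK.
  by move=> t /andP[t1 _]; exact: Dfin.
(* The 1 pays for round 1, played without data; the rest bounds the sum of the expected dominating
   variables of the bad events. *)
exists (1 + K * (1 + (th - 1)^-1)) => T T1.
rewrite ED// big_ltn//.
have D1 : (\int[P]_w (D 1%N w)%:E <= 1)%E.
  rewrite -(integral_prob_cst P 1); apply: le_integral_fin => //; first exact: mD.
  by move=> w; exact: D01.
have rest : (\sum_(2 <= t < T.+1) \int[P]_w (D t w)%:E <=
    (4 / A)%:E * \int[P]_w (\sum_(1 <= n < T) rw n w)%:E
    + (K * (1 + (th - 1)^-1))%:E)%E.
  rewrite big_add1/=.
  apply: (@le_trans _ _ (\sum_(1 <= n < T) ((4 / A)%:E * \int[P]_w (rw n w)%:E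
      + (K * expR (- (th * ln n%:R)))%:E))%E).
    rewrite big_nat [leRHS]big_nat; apply: lee_sum => n /andP[n1 _].
    exact: step.
  rewrite big_split/= leeD//.
    rewrite integral_fin_sum// ge0_sume_distrr// => n _.
    by apply: integral_ge0 => w _; rewrite lee_fin.
  rewrite sumEFin lee_fin -mulr_sumr ler_wpM2l//.
  have := @sum_inv_power_le R (th - 1) T; rewrite subr_gt0 => /(_ th1).
  by rewrite [1 + (th - 1)]addrCA subrr addr0.
have rwT : (\int[P]_w (\sum_(1 <= n < T) rw n w)%:E <=
    (Num.sqrt (gamma * ln T%:R / 2) * (2 * Num.sqrt T%:R))%:E)%E.
  rewrite -(integral_prob_cst P); apply: le_integral_fin => //.
    exact: measurable_sum_nat.
  move=> w; rewrite sumr_ge0//=; apply: sum_win_radius_le => // s; exact: M01.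
apply: (le_trans (leeD D1 rest)).
apply: (@le_trans _ _ (1%:E + ((4 / A)%:E *
    (Num.sqrt (gamma * ln T%:R / 2) * (2 * Num.sqrt T%:R))%:E
    + (K * (1 + (th - 1)^-1))%:E))%E).
  by rewrite leeD2l// leeD2r// lee_wpmul2l// lee_fin.
rewrite -EFinM -!EFinD lee_fin.
have L0 := @ln_nat_ge0 R T.
have gL0 : 0 <= gamma * ln (T%:R : R) by rewrite mulr_ge0.
have s2 : Num.sqrt (gamma * ln (T%:R : R) / 2) * 2 =
    Num.sqrt 2 * Num.sqrt (gamma * ln (T%:R : R)).
  have s20 : Num.sqrt (2 : R) != 0 by rewrite gt_eqF// sqrtr_gt0.
  rewrite sqrtrM// sqrtrV// -[X in _ * X = _](@sqr_sqrtr R 2)//.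
  by field.
have -> : 4 / A * (Num.sqrt (gamma * ln T%:R / 2) * (2 * Num.sqrt T%:R)) =
    4 * Num.sqrt 2 / A * Num.sqrt (gamma * ln T%:R) * Num.sqrt T%:R.
  rewrite [Num.sqrt (gamma * ln T%:R / 2) * _]mulrA s2.
  by field; rewrite gt_eqF.
rewrite -/A mulrDr mulr1.
have : 0 <= 4 * Num.sqrt 2 / A * Num.sqrt (gamma * ln (T%:R : R)).
  by rewrite !mulr_ge0 ?sqrtr_ge0// invr_ge0 ltW.
lra.
Qed.
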